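(* Let $\Gamma$ be a countable set equipped with a metric $d$ and a function $G:\Gamma\times\Gamma\to(0,\infty)$ such that (i) $G(x,y)=G(y,x)$ for all $x,y\in\Gamma$; (ii) $\sum_{z\in\Gamma}G(x,z)G(z,y)\le G(x,y)$ for all $x,y\in\Gamma$; (iii) $x\mapsto\sum_{z\in\Gamma}G(x,z)$ is uniformly bounded on $\Gamma$. Let $I\subset\mathbb{R}$ be an interval and let $\Phi\in\mathcal{B}_G^+(I)$. For $\Lambda\in\mathcal{P}_0(\Gamma)$, let $\tau^\Lambda_{t,s}$ be the finite-volume dynamics associated to $\Phi$. Let $X,Y\subset\Lambda$ with $X\cap Y=\emptyset$. (i) If $A\in\mathcal{A}_X$, $B\in\mathcal{A}_Y$, and $[A,B]=0$, then for all $t,s\in I$ with $s\le t$, $$\left\|[\tau^\Lambda_{t,s}(A),B]\right\|\le 2\|A\|\|B\|\left(\exp\left[2\int_s^t\|\Phi\|_G(r)\,dr\right]-1\right)\sum_{x\in\partial_\Phi X}\sum_{y\in Y}G(x,y).$$ (ii) If $A\in\mathcal{A}_X$, $B\in\mathcal{A}_Y$, and $\{A,B\}=0$, then for all $t,s\in I$ with $s\le t$, $$\left\|\{\tau^\Lambda_{t,s}(A),B\}\right\|\le 2\|A\|\|B\|\left(\exp\left[2\int_s^t\|\Phi\|_G(r)\,dr\right]-1\right)\sum_{x\in\partial_\Phi X}\sum_{y\in Y}G(x,y).$$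
   Context: Notation: $[A,B]=AB-BA$, $\{A,B\}=AB+BA$, and $\mathbb{1}$ is the identity. $\mathcal{A}_\Gamma=\mathrm{CAR}(\ell^2(\Gamma))$ is the $C^*$-algebra generated by $a_x,a_x^*$, $x\in\Gamma$, with $\{a_x,a_y\}=\{a_x^*,a_y^*\}=0$ and $\{a_x,a_y^*\}=\delta_{x,y}\mathbb{1}$. For $X\subset\Gamma$, $\mathcal{A}_X\subset\mathcal{A}_\Gamma$ is the $C^*$-subalgebra generated by $a_x,a_x^*$, $x\in X$. $\mathcal{P}_0(\Gamma)$ is the set of finite subsets of $\Gamma$. For $X\in\mathcal{P}_0(\Gamma)$, the parity automorphism of $\mathcal{A}_X$ is $\Theta_X(A)=(-1)^{N_X}A(-1)^{N_X}$ with $N_X=\sum_{x\in X}a_x^*a_x$, and $\mathcal{A}_X^+$ (even elements), $\mathcal{A}_X^-$ (odd elements) are its eigenspaces for eigenvalues $+1$, $-1$. An even, time-dependent interaction is a map $\Phi:\mathcal{P}_0(\Gamma)\times I\to\mathcal{A}_\Gamma$ with $\Phi(X,t)^*=\Phi(X,t)\in\mathcal{A}_X^+$ for all $X\in\mathcal{P}_0(\Gamma)$, $t\in I$, and with $t\mapsto\Phi(X,t)$ norm continuous for each $X$. Such a $\Phi$ belongs to $\mathcal{B}_G^+(I)$ if there is a locally integrable function $\|\Phi\|_G:I\to[0,\infty)$ with $$\sum_{Z\in\mathcal{P}_0(\Gamma):\,x,y\in Z}\|\Phi(Z,t)\|\le\|\Phi\|_G(t)\,G(x,y)\quad\text{for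 all }x,y\in\Gamma,\ t\in I;$$ $\|\Phi\|_G$ in the claim denotes this function. For $\Lambda\in\mathcal{P}_0(\Gamma)$, $H_\Lambda(t)=\sum_{X\subset\Lambda}\Phi(X,t)$; $U_\Lambda(t,s)\in\mathcal{A}_\Lambda$ is the unitary solution of $\frac{d}{dt}U_\Lambda(t,s)=-iH_\Lambda(t)U_\Lambda(t,s)$, $U_\Lambda(s,s)=\mathbb{1}$, $s,t\in I$; and the finite-volume dynamics is $\tau^\Lambda_{t,s}(A)=U_\Lambda(t,s)^*AU_\Lambda(t,s)$ for $A\in\mathcal{A}_\Lambda$. The surface sets of $X$ in $\Lambda\subset\Gamma$ are $S_\Lambda(X)=\{Z\in\mathcal{P}_0(\Lambda): Z\cap X\ne\emptyset,\ Z\cap(\Lambda\setminus X)\neq\emptyset\}$. The $\Phi$-boundary of $X\in\mathcal{P}_0(\Gamma)$ is $\partial_\Phi X=\{x\in X:\exists Z\in S_\Gamma(X),\,t\in I\text{ with }x\in Z\text{ and }\Phi(Z,t)\ne0\}$. *)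

(* Defs.v *)
From HB Require Import structures.
From mathcomp Require Import all_boot all_order all_algebra finmap complex.
From mathcomp Require Import all_classical all_reals all_analysis.

Set Implicit Arguments.
Unset Strict Implicit.
Unset Printing Implicit Defensive.

Import Order.TTheory GRing.Theory Num.Theory numFieldNormedType.Exports.

Local Open Scope classical_set_scope.
Local Open Scope ring_scope.

(* Unital complex C*-algebras, with a real-valued norm [cnorm].  The algebra
   structure cannot be joined with the library's normed modules by HB (such a join
   would have to precede [Num.NumDomain]), so the norm axioms are given here and
   the normed module, hence the norm topology, is derived from them below. *)
HB.mixin Record Algebra_isCStarAlg (R : realType) A of GRing.Algebra R[i] A := {
  cnorm : A -> R;
  cnormD : forall a b, cnorm (a + b) <= cnorm a + cnorm b;
  cnormZ : forall (k : R[i]) a,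
    cnorm (k *: a) = ComplexField.Normc.normc k * cnorm a;
  cnorm_eq0 : forall a, cnorm a = 0 -> a = 0;
  cnormM : forall a b, cnorm (a * b) <= cnorm a * cnorm b;
  cnorm_complete : forall u : nat -> A,
    (forall e, 0 < e -> exists N, forall m n,
       (N <= m)%N -> (N <= n)%N -> cnorm (u m - u n) < e) ->
    exists l, forall e, 0 < e -> exists N, forall n,
       (N <= n)%N -> cnorm (u n - l) < e;
  star : A -> A;
  starK : forall a, star (star a) = a;
  starD : forall a b, star (a + b) = star a + star b;
  starZ : forall (k : R[i]) a, star (k *: a) = (k^*)%C *: star a;
  starM : forall a b, star (a * b) = star b * star a;
  cstar_identity : forall a, cnorm (star a * a) = cnorm a ^+ 2
}.

#[short(type="cstarAlgType")]
HB.structure Definition CStarAlg (R : realType) :=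
  { A of GRing.Algebra R[i] A & Algebra_isCStarAlg R A }.

Section CStarNormedModule.
Variables (R : realType) (A : cstarAlgType R).

(* The library's norm of a complex normed module is R[i]-valued. *)
Let norm (a : A) : R[i] := (cnorm a)%:C%C.

Let normD a b : norm (a + b) <= norm a + norm b.
Proof. by rewrite /norm -rmorphD /= lecR cnormD. Qed.

Let normZ (k : R[i]) a : norm (k *: a) = `|k| * norm a.
Proof. by rewrite /norm cnormZ rmorphM. Qed.

Let norm_eq0 a : norm a = 0 -> a = 0.
Proof.
by move=> /eqP; rewrite /norm (inj_eq (@complexI R) _ 0) => /eqP /cnorm_eq0.
Qed.

HB.instance Definition _ :=
  @Lmodule_isNormed.Build R[i] A norm normD normZ norm_eq0.

End CStarNormedModule.

Section CStar.
Variables (R : realType) (A : cstarAlgType R).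
Implicit Types (a b : A) (B S : set A).

Definition commutator a b : A := a * b - b * a.
Definition anticommutator a b : A := a * b + b * a.

Definition unitary a : Prop := star a * a = 1 /\ a * star a = 1.

Definition cstar_subalg B : Prop :=
  [/\ B 1,
      forall a b, B a -> B b -> B (a + b) /\ B (a * b),
      forall (k : R[i]) a, B a -> B (k *: a),
      forall a, B a -> B (star a)
    & closed B].

Definition cstar_generated S : set A :=
  [set a | forall B, cstar_subalg B -> S `<=` B -> B a].

Definition cstar_exp a : A :=
  limn (fun n => \sum_(0 <= k < n) ((k`!)%:R : R[i])^-1 *: a ^+ k).

End CStar.

Section CAR.
Variables (R : realType) (A : cstarAlgType R) (Gamma : countType).
Variable a : Gamma -> A.
Implicit Types X Y Z L : {fset Gamma}.

Definition local_alg (X : set Gamma) : set A := cstar_generated (a @` X).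

(* [A] with the family [a] is CAR(l^2(Gamma)): this determines it up to a
   *-isomorphism respecting the generators. *)
Definition is_CAR_algebra : Prop :=
  [/\ forall x y, anticommutator (a x) (a y) = 0,
      forall x y, anticommutator (star (a x)) (star (a y)) = 0,
      forall x y, anticommutator (a x) (star (a y)) = (x == y)%:R
    & local_alg setT = setT].

Definition number_op X : A := \sum_(x <- X) star (a x) * a x.

(* (-1)^N = exp(i pi N) *)
Definition parity_op X : A := cstar_exp ((0 +i* pi)%C *: number_op X).

Definition parity X (b : A) : A := parity_op X * b * parity_op X.

Definition even_alg X : set A :=
  local_alg [set` X] `&` [set b | parity X b = b].

(* Time-dependent objects are total in time; only times in [I] are constrained. *)
Definition even_interaction (I : interval R) (Phi : {fset Gamma} -> R -> A) :
    Prop :=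
  [/\ forall X t, t \in I -> star (Phi X t) = Phi X t,
      forall X t, t \in I -> even_alg X (Phi X t)
    & forall X, {within [set` I], continuous (Phi X)}].

(* The library's [locally_integrable] requires an open domain. *)
Definition loc_integrable (I : interval R) (f : R -> R) : Prop :=
  forall K : set R, compact K -> K `<=` [set` I] ->
    (@lebesgue_measure R).-integrable K (EFin \o f).

(* [Phi] belongs to B_G^+(I), with the function [phiG] as ||Phi||_G. *)
Definition in_BG (I : interval R) (G : Gamma -> Gamma -> R)
    (Phi : {fset Gamma} -> R -> A) (phiG : R -> R) : Prop :=
  [/\ even_interaction I Phi,
      loc_integrable I phiG,
      forall t, t \in I -> 0 <= phiG t
    & forall x y t, t \in I ->
        (\esum_(Z in [set Z : {fset Gamma} | x \in Z /\ y \in Z])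
           (cnorm (Phi Z t))%:E <= (phiG t * G x y)%:E)%E].

Definition hamiltonian (Phi : {fset Gamma} -> R -> A) L (t : R) : A :=
  \sum_(X <- fpowerset L) Phi X t.

(* The derivative is taken within [I], hence one-sided at its endpoints. *)
Definition has_derivative_within (I : interval R) (f : R -> A) (t : R) (l : A) :
    Prop :=
  (fun u => ((u - t)^-1)%:C%C *: (f u - f t)) @ within [set` I] t^' --> l.

Definition is_propagator (I : interval R) (Phi : {fset Gamma} -> R -> A) L
    (U : R -> R -> A) : Prop :=
  forall s, s \in I ->
    U s s = 1 /\
    forall t, t \in I ->
      [/\ local_alg [set` L] (U t s), unitary (U t s)
        & has_derivative_within I (U ^~ s) t
            (- ((0 +i* 1)%C *: (hamiltonian Phi L t * U t s)))].

Definition dynamics (U : R -> R -> A) (t s : R) (b : A) : A :=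
  star (U t s) * b * U t s.

Definition surface_sets (L X : set Gamma) : set {fset Gamma} :=
  [set Z : {fset Gamma} | [/\ [set` Z] `<=` L, [set` Z] `&` X !=set0
             & [set` Z] `&` (L `\` X) !=set0]].

Definition Phi_boundary (I : interval R) (Phi : {fset Gamma} -> R -> A) X :
    {fset Gamma} :=
  [fset x in X | `[< exists Z t, [/\ surface_sets setT [set` X] Z, t \in I,
                                     x \in Z & Phi Z t <> 0] >]]%fset.

End CAR.

Definition is_metric (R : realType) (T : Type) (d : T -> T -> R) : Prop :=
  [/\ forall x y, 0 <= d x y,
      forall x y, d x y = 0 <-> x = y,
      forall x y, d x y = d y x
    & forall x y z, d x z <= d x y + d y z].

Definition is_decay_kernel (R : realType) (T : choiceType) (G : T -> T -> R) :
    Prop :=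
  [/\ forall x y, 0 < G x y,
      forall x y, G x y = G y x,
      forall x y,
        (\esum_(z in [set: T]) (G x z * G z y)%:E <= (G x y)%:E)%E
    & exists M : R, forall x, (\esum_(z in [set: T]) (G x z)%:E <= M%:E)%E].

(* Main.v *)
Require Import Defs.
From mathcomp Require Import all_boot all_order all_algebra finmap complex.
From mathcomp Require Import all_classical all_reals all_analysis.
From mathcomp Require Import ring lra.

Set Implicit Arguments.
Unset Strict Implicit.
Unset Printing Implicit Defensive.

Import Order.TTheory GRing.Theory Num.Theory numFieldNormedType.Exports.

Local Open Scope classical_set_scope.
Local Open Scope ring_scope.

(** The propagator is compared with the product of three first-order factors
    [1 - i h H2], [1 - i h H0], [1 - i h H1], where [H0], [H1], [H2] collect the
    interaction terms inside [Z], on the surface of [Z], and away from [Z].  The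
    terms away from [Z] commute with an observable of [Z], conjugation by the
    factor of [H0] keeps it an observable of [Z] with the same (graded)
    commutation relation to [c], and the factor of [H1] contributes the
    commutators of the surface terms with [c].  Since [1 - i h H] has norm
    [1 + O(h^2)] for self-adjoint [H], this gives a differential inequality for
    the norm of the graded commutator in which no interaction-picture dynamics
    has to be constructed.  Evenness makes each surface term an observable to
    which the same inequality applies, with ordinary commutators, so the system
    closes, and [2 |c| (exp (2 int phiG) - 1) sum_(x in bdry Z) sum_(y in Y) G x y]
    is a supersolution by the convolution inequality for [G]; continuous
    induction on time does the comparison. *)

(** * Norms and graded commutators in a C*-algebra *)

Section CStarNorm.
Variables (R : realType) (A : cstarAlgType R).
Implicit Types a b c : A.

Lemma normc_ge0 (k : R[i]) : 0 <= ComplexField.Normc.normc k.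
Proof. by case: k => x y; rewrite sqrtr_ge0. Qed.

Lemma normc_imag (h : R) : ComplexField.Normc.normc (0 +i* h)%C = `|h|.
Proof. by rewrite /= expr0n add0r sqrtr_sqr. Qed.

Lemma normc_real (h : R) : ComplexField.Normc.normc h%:C%C = `|h|.
Proof. by rewrite /= expr0n addr0 sqrtr_sqr. Qed.

Lemma cnorm0 : cnorm (0 : A) = 0.
Proof.
by rewrite -(scale0r (0 : A)) cnormZ -[0 : R[i]]/(0%:C%C) normc_real normr0 mul0r.
Qed.

Lemma cnormN a : cnorm (- a) = cnorm a.
Proof.
by rewrite -scaleN1r cnormZ /= oppr0 expr0n addr0 sqrrN expr1n sqrtr1 mul1r.
Qed.

Lemma cnorm_ge0 a : 0 <= cnorm a.
Proof.
have := cnormD a (- a); rewrite cnormN subrr cnorm0 => h.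
by rewrite -(@pmulrn_lge0 _ _ 2%N) // mulr2n.
Qed.

Lemma cnormB a b : cnorm (a - b) <= cnorm a + cnorm b.
Proof. by rewrite (le_trans (cnormD _ _)) // cnormN. Qed.

Lemma cnorm_subC a b : cnorm (a - b) = cnorm (b - a).
Proof. by rewrite -cnormN opprB. Qed.

Lemma cnorm_dist a b : `|cnorm a - cnorm b| <= cnorm (a - b).
Proof.
have h x y : cnorm x - cnorm y <= cnorm (x - y).
  by rewrite lerBlDr -{1}(subrK y x) cnormD.
by rewrite ler_norml lerNl opprB h cnorm_subC h.
Qed.

Lemma cnorm_sum (J : Type) (s : seq J) (P : pred J) (F : J -> A) :
  cnorm (\sum_(j <- s | P j) F j) <= \sum_(j <- s | P j) cnorm (F j).
Proof.
apply: (big_ind2 (fun x y => cnorm x <= y)) => // [|x x' y y' hx hy].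
  by rewrite cnorm0.
exact: le_trans (cnormD _ _) (lerD hx hy).
Qed.

Lemma cnormM_le a b (x y : R) :
  cnorm a <= x -> cnorm b <= y -> cnorm (a * b) <= x * y.
Proof.
by move=> ha hb; rewrite (le_trans (cnormM _ _)) // ler_pM // cnorm_ge0.
Qed.

Lemma star0 : star (0 : A) = 0.
Proof. by apply: (addrI (star (0 : A))); rewrite -starD !addr0. Qed.

Lemma starN a : star (- a) = - star a.
Proof. by apply/eqP; rewrite -addr_eq0 -starD addNr star0. Qed.

Lemma starB a b : star (a - b) = star a - star b.
Proof. by rewrite starD starN. Qed.

Lemma star1 : star (1 : A) = 1.
Proof.
by rewrite -[LHS]mulr1 -[X in _ * X](starK (1 : A)) -starM mulr1 starK.
Qed.

Lemma star_sum (J : Type) (s : seq J) (P : pred J) (F : J -> A) :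
  star (\sum_(j <- s | P j) F j) = \sum_(j <- s | P j) star (F j).
Proof. exact: (big_morph _ starD star0). Qed.

Lemma cnorm1 : cnorm (1 : A) = 1.
Proof.
have h := cstar_identity (1 : A); rewrite star1 mulr1 in h.
have n0 : cnorm (1 : A) != 0.
  by apply/eqP => /cnorm_eq0 /eqP; rewrite oner_eq0.
by apply: (mulfI n0); rewrite mulr1 -expr2 -h.
Qed.

(** The C*-identity gives $|b|^2 = |b^*b| \le |b^*|\,|b|$; cancelling $|b|$ and applying the result
    to $b$ and to $b^*$ gives both inequalities. *)
Lemma cnorm_star a : cnorm (star a) = cnorm a.
Proof.
have le b : cnorm b <= cnorm (star b).
  have [/cnorm_eq0 ->|b0] := eqVneq (cnorm b) 0.
    by rewrite star0 lexx.
  have bp : 0 < cnorm b by rewrite lt_def b0 cnorm_ge0.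
  by rewrite -(ler_pM2r bp) -expr2 -cstar_identity cnormM.
by apply/eqP; rewrite eq_le le -{2}(starK a) le.
Qed.

Lemma cnorm_unitary a : unitary a -> cnorm a = 1.
Proof.
case=> h _; have := cstar_identity a; rewrite h cnorm1 => /esym/eqP.
rewrite sqrf_eq1 => /orP[/eqP //|/eqP e].
by have := cnorm_ge0 a; rewrite e oppr_ge0 ler10.
Qed.

(* [1 - i h a] is unitary to first order in [h] when [a] is self-adjoint. *)
Definition euler (h : R) a : A := 1 - (0 +i* h)%C *: a.

Lemma star_euler h a : star a = a -> star (euler h a) = 1 + (0 +i* h)%C *: a.
Proof.
move=> sa; rewrite /euler starB star1 starZ sa -scaleNr; congr (_ + _ *: _).
by apply/eqP; rewrite eq_complex /= oppr0 opprK !eqxx.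
Qed.

Lemma star_eulerM h a : star a = a ->
  star (euler h a) * euler h a = 1 + (h ^+ 2)%:C%C *: (a * a).
Proof.
move=> sa; rewrite star_euler // /euler mulrDl mul1r mulrBr mulr1.
rewrite addrA subrK -scalerAl -scalerAr scalerA -scaleNr.
congr (_ + _ *: _); apply/eqP; rewrite eq_complex /=.
by rewrite !(mul0r, mulr0, addr0) sub0r opprK expr2 oppr0 !eqxx.
Qed.

(** The first-order terms cancel in [star_eulerM], so conjugation by a self-adjoint factor changes
    norms only at order [h ^+ 2] and leaves no trace in a differential inequality. *)
Lemma cnorm_euler_sq h a : star a = a ->
  cnorm (euler h a) ^+ 2 <= 1 + h ^+ 2 * cnorm a ^+ 2.
Proof.
move=> sa; rewrite -cstar_identity star_eulerM // (le_trans (cnormD _ _)) //.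
rewrite cnorm1 lerD2l cnormZ normc_real ger0_norm ?sqr_ge0 //.
by rewrite ler_wpM2l ?sqr_ge0 // expr2 cnormM.
Qed.

Lemma cnorm_euler h a : cnorm (euler h a) <= 1 + `|h| * cnorm a.
Proof.
by rewrite (le_trans (cnormB _ _)) // cnorm1 cnormZ normc_imag.
Qed.

(** The values 1 and -1 of [k] give the commutator and the anticommutator, so both claims are proved
    at once; the estimates use only that [k] has modulus one. *)
Definition gcomm (k : R[i]) a b : A := a * b - k *: (b * a).

Lemma gcomm1 a b : gcomm 1 a b = commutator a b.
Proof. by rewrite /gcomm scale1r. Qed.

Lemma gcommN1 a b : gcomm (-1) a b = anticommutator a b.
Proof. by rewrite /gcomm scaleN1r opprK. Qed.

Lemma gcommDl k a b c : gcomm k (a + b) c = gcomm k a c + gcomm k b c.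
Proof. by rewrite /gcomm mulrDl mulrDr scalerDr opprD addrACA. Qed.

Lemma cnorm_gcomm k a b : ComplexField.Normc.normc k = 1 ->
  cnorm (gcomm k a b) <= 2 * cnorm b * cnorm a.
Proof.
move=> k1; rewrite (le_trans (cnormB _ _)) // cnormZ k1 mul1r.
rewrite -mulrA mulr2n mulrDl mul1r; apply: lerD; last exact: cnormM.
by rewrite mulrC cnormM.
Qed.

(* Up to commutators with [t], conjugation by [t] commutes with the graded
   commutator. *)
Lemma gcomm_conj k a b t :
  gcomm k (star t * a * t) b =
  star t * gcomm k a b * t + star t * a * commutator t b
  - k *: (commutator b (star t) * a * t).
Proof.
rewrite /gcomm /commutator !mulrBr !mulrBl -!scalerAr -!scalerAl !scalerBr.
rewrite !mulrA opprB.
set p := star t * a * b * t; set q := k *: (star t * b * a * t).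
set r := star t * a * t * b; set s := k *: (b * star t * a * t).
by rewrite [p - q + _]addrC !addrA !subrK.
Qed.

End CStarNorm.

(** * Convergence and the exponential of an imaginary number *)

Section CStarTopology.
Variables (R : realType) (A : cstarAlgType R).
Implicit Types a b c : A.

Lemma normrE a : `|a| = (cnorm a)%:C%C.
Proof. by []. Qed.

Lemma complex_gt0 (e : R[i]) : 0 < e -> exists2 r : R, 0 < r & e = r%:C%C.
Proof.
by case: e => x y; rewrite ltcE /= => /andP[/eqP -> x0]; exists x.
Qed.

Lemma cvg_cnormP (T : Type) (F : set_system T) (FF : Filter F) (f : T -> A) l :
  f @ F --> l <-> forall e : R, 0 < e -> \forall u \near F, cnorm (f u - l) < e.
Proof.
split=> [/cvgrPdist_lt h e e0|h].
  have e0' : (0 : R[i]) < e%:C%C by rewrite ltcR.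
  have := h _ e0'; apply: filterS => u; rewrite normrE ltcR cnorm_subC //.
apply/cvgrPdist_lt => e /complex_gt0[r r0 ->].
by have := h _ r0; apply: filterS => u; rewrite normrE ltcR cnorm_subC.
Qed.

(** Supplies the closedness clause of [cstar_subalg] for sets cut out by commutation relations. *)
Lemma closed_bounded_kernel (f : A -> A) (C : R) :
  (forall a b, f (a - b) = f a - f b) ->
  (forall a, cnorm (f a) <= C * cnorm a) ->
  closed [set a | f a = 0].
Proof.
move=> fB fC a acl; apply: cnorm_eq0; apply/eqP; rewrite eq_le cnorm_ge0 andbT.
apply/ler_addgt0Pl => e e0; rewrite addr0.
(* [C] carries no sign condition, so the strictly positive constant [|C| + 1] replaces it. *)
have d0 : 0 < e / (`|C| + 1) by rewrite divr_gt0 // ltr_pwDr.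
have d0' : (0 : R[i]) < (e / (`|C| + 1))%:C%C by rewrite ltcR.
have [b [/= fb0]] := acl _ (nbhsx_ballx a _ d0').
rewrite -ball_normE /= normrE ltcR => ab.
rewrite -[f a]subr0 -fb0 -fB (le_trans (fC _)) //.
apply: (le_trans (_ : _ <= (`|C| + 1) * cnorm (a - b))).
  by rewrite ler_wpM2r ?cnorm_ge0 // (le_trans (ler_norm C)) // lerDl.
rewrite -ler_pdivlMl ?ltr_pwDr // mulrC; exact: ltW.
Qed.

Lemma cstar_expE (a : A) l :
  (fun n => \sum_(0 <= k < n) ((k`!)%:R : R[i])^-1 *: a ^+ k) @ \oo --> l ->
  cstar_exp a = l.
Proof. by move=> /cvg_lim; apply; exact: norm_hausdorff. Qed.

End CStarTopology.

Section ImaginaryExponential.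
Variable R : realType.
Implicit Types x : R.

Lemma imag_expr_double x n :
  (0 +i* x)%C ^+ n.*2 = ((-1) ^+ n * x ^+ n.*2)%:C%C.
Proof.
rewrite -mul2n !exprM -exprNn (rmorphXn (real_complex R)) /=; congr (_ ^+ n).
apply/eqP; rewrite eq_complex /= !mulr0 !mul0r sub0r addr0 !expr2.
by rewrite !eqxx.
Qed.

(** The two components are shaped like [cos_coeff] and [sin_coeff], so partial sums match term by
    term. At [n = 0] the truncated [n.-1] is harmless because its parity indicator vanishes. *)
Lemma imag_expr x n :
  (0 +i* x)%C ^+ n =
  (((~~ odd n)%:R * (-1) ^+ n./2 * x ^+ n)
   +i* ((odd n)%:R * (-1) ^+ n.-1./2 * x ^+ n))%C.
Proof.
rewrite -(odd_double_half n); case: (odd n) => /=.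
  rewrite !add1n /= odd_double uphalf_double exprS imag_expr_double /= !mul1r !mul0r.
  apply/eqP; rewrite eq_complex /= exprS doubleK.
  by apply/andP; split; apply/eqP; ring.
rewrite !add0n imag_expr_double odd_double /= doubleK.
by apply/eqP; rewrite eq_complex /= !mul0r mul1r !eqxx.
Qed.

Lemma imag_exp_series x n :
  \sum_(0 <= k < n) ((k`!)%:R : R[i])^-1 * (0 +i* x)%C ^+ k =
  ((series (cos_coeff x) n) +i* (series (sin_coeff x) n))%C.
Proof.
rewrite /series /=; elim: n => [|n IHn]; first by rewrite !big_nil.
rewrite !big_nat_recr //= IHn imag_expr.
have -> : ((n`!)%:R : R[i])^-1 = ((n`!)%:R^-1)%:C%C.
  by rewrite rmorphV ?unitfE ?pnatr_eq0 -?lt0n ?fact_gt0 // rmorph_nat.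
rewrite /cos_coeff /sin_coeff /= -exprnP.
apply/eqP; rewrite eq_complex /=.
by apply/andP; split; apply/eqP; ring.
Qed.

Lemma cos_natpi m : cos (m%:R * pi) = (-1) ^+ m :> R.
Proof.
have := alternatingn (@cosDpi R) m 0; rewrite add0r cos0 mulr1 => <-.
by rewrite mulr_natl.
Qed.

Lemma sin_natpi m : sin (m%:R * pi) = 0 :> R.
Proof.
have := alternatingn (@sinDpi R) m 0; rewrite add0r sin0 mulr0 => <-.
by rewrite mulr_natl.
Qed.

Lemma normc_le (u v : R) : ComplexField.Normc.normc (u +i* v)%C <= `|u| + `|v|.
Proof.
rewrite /= -[leRHS]ger0_norm ?addr_ge0 // -sqrtr_sqr ler_wsqrtr // sqrrD.
by rewrite !real_normK ?num_real // lerD2r lerDl mulrn_wge0 // mulr_ge0.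
Qed.

Lemma imag_exp_cvg x (e : R) : 0 < e ->
  \forall n \near \oo, ComplexField.Normc.normc
    (\sum_(0 <= k < n) ((k`!)%:R : R[i])^-1 * (0 +i* x)%C ^+ k
     - (cos x +i* sin x)%C) < e.
Proof.
move=> e0; have e2 : 0 < e / 2 by rewrite divr_gt0.
have cc : series (cos_coeff x) @ \oo --> cos x.
  by rewrite unlock; exact: is_cvg_series_cos_coeff.
have cs : series (sin_coeff x) @ \oo --> sin x.
  by rewrite unlock; exact: is_cvg_series_sin_coeff.
have nc := (cvgrPdist_lt _ _).1 cc _ e2; have ns := (cvgrPdist_lt _ _).1 cs _ e2.
near=> n; rewrite imag_exp_series.
apply: le_lt_trans (normc_le _ _) _; rewrite [e]splitr.
by apply: ltrD; rewrite distrC; near: n; [exact: nc|exact: ns].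
Unshelve. all: by end_near. Qed.

End ImaginaryExponential.

(** * Parity and commutation of even elements in the CAR algebra *)

Section CARParity.
Variables (R : realType) (A : cstarAlgType R) (Gamma : countType).
Variable a : Gamma -> A.
Hypothesis ha : is_CAR_algebra a.

Definition occupation x : A := star (a x) * a x.
(** Since [occupation x] is a projection, this is $(-1)^{n_x}$ in polynomial form. *)
Definition site_parity x : A := 1 - occupation x *+ 2.
Local Notation n := occupation.
Local Notation t := site_parity.

Lemma double_eq0 (b : A) : b + b = 0 -> b = 0.
Proof.
rewrite -mulr2n -scaler_nat => /eqP.
by rewrite scaler_eq0 pnatr_eq0 /= => /eqP.
Qed.

Lemma annihilator_sq x : a x * a x = 0.
Proof. by case: ha => h _ _ _; apply: double_eq0; exact: (h x x). Qed.

Lemma annihilatorC x y : a y * a x = - (a x * a y).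
Proof. by case: ha => h _ _ _; apply/eqP; rewrite -addr_eq0; apply/eqP/h. Qed.

Lemma annihilator_starC x y : y != x -> a y * star (a x) = - (star (a x) * a y).
Proof.
case: ha => _ _ h _ yx; apply/eqP; rewrite -addr_eq0; apply/eqP.
by have := h y x; rewrite (negbTE yx).
Qed.

Lemma annihilator_star x : a x * star (a x) = 1 - n x.
Proof.
case: ha => _ _ h _; apply/eqP; rewrite eq_sym subr_eq eq_sym; apply/eqP.
by have := h x x; rewrite eqxx.
Qed.

Lemma occupation_idem x : n x * n x = n x.
Proof.
rewrite /n mulrA -(mulrA (star (a x))) annihilator_star mulrBr mulr1 mulrBl.
by rewrite /n -[X in _ - X]mulrA -[X in _ - _ * X]mulrA annihilator_sq !mulr0 subr0.
Qed.

Lemma star_occupation x : star (n x) = n x.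
Proof. by rewrite /n starM starK. Qed.

Lemma annihilator_occupation x y : y != x -> a y * n x = n x * a y.
Proof.
move=> yx; rewrite /n mulrA annihilator_starC // mulNr -!mulrA.
by rewrite (annihilatorC x y) mulrN opprK.
Qed.

Lemma creator_occupation x y : y != x -> star (a y) * n x = n x * star (a y).
Proof.
move=> yx; rewrite -[LHS]starK starM star_occupation starK.
by rewrite -annihilator_occupation // starM star_occupation.
Qed.

Lemma occupationC x y : n x * n y = n y * n x.
Proof.
have [->//|xy] := eqVneq x y.
by rewrite {1}/n -mulrA annihilator_occupation // mulrA creator_occupation // mulrA.
Qed.

Lemma star_site_parity x : star (t x) = t x.
Proof. by rewrite /t starB star1 mulr2n starD star_occupation. Qed.

Lemma site_parity_sq x : t x * t x = 1.
Proof.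
have dd : (n x *+ 2) * (n x *+ 2) = n x *+ 2 + n x *+ 2.
  by rewrite mulrnAl mulrnAr occupation_idem [LHS]mulr2n.
by rewrite /t mulrBr mulr1 mulrBl mul1r dd opprB addrK subrK.
Qed.

Lemma site_parity_annihilator x y :
  t y * a x = (-1) ^+ (x == y) * (a x * t y).
Proof.
rewrite /t mulrBl mul1r mulrBr mulr1 mulrnAl mulrnAr.
have [->|xy] := eqVneq x y.
  rewrite /n -mulrA annihilator_sq mulr0 mul0rn subr0 mulrA annihilator_star.
  rewrite mulrBl mul1r -mulrA annihilator_sq mulr0 subr0 mulr2n opprD addrA.
  by rewrite subrr sub0r expr1 mulN1r opprK.
by rewrite expr0 mul1r annihilator_occupation.
Qed.

Definition parity_prod (s : seq Gamma) : A := \prod_(x <- s) t x.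

(** Only the factor at [x] anticommutes with [a x], and uniqueness makes it occur at most once. *)
Lemma parity_prod_annihilator s x : uniq s ->
  parity_prod s * a x = (-1) ^+ (x \in s) * (a x * parity_prod s).
Proof.
rewrite /parity_prod; elim: s => [|y s IHs] /=.
  by rewrite big_nil expr0 !mul1r mulr1.
move=> /andP[ys us]; rewrite big_cons -mulrA IHs // in_cons.
rewrite (mulrA (t y)) commr_sign -mulrA (mulrA (t y)).
rewrite site_parity_annihilator !mulrA -exprD addnC; congr (_ * _ * _ * _).
by have [->|xy] := eqVneq x y; rewrite ?(negbTE ys) // addn0.
Qed.

Lemma site_parity_creator x y :
  t y * star (a x) = (-1) ^+ (x == y) * (star (a x) * t y).
Proof.
rewrite -[LHS]starK starM starK star_site_parity.
have -> : a x * t y = (-1) ^+ (x == y) * (t y * a x).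
  by rewrite site_parity_annihilator [RHS]mulrA -signr_addb addbb mul1r.
rewrite starM [star (t y * a x)]starM star_site_parity -commr_sign.
by case: (x == y); rewrite ?expr1 ?expr0 ?starN star1.
Qed.

Lemma parity_prod_creator s x : uniq s ->
  parity_prod s * star (a x) = (-1) ^+ (x \in s) * (star (a x) * parity_prod s).
Proof.
rewrite /parity_prod; elim: s => [|y s IHs] /=.
  by rewrite big_nil expr0 !mul1r mulr1.
move=> /andP[ys us]; rewrite big_cons -mulrA IHs // in_cons.
rewrite (mulrA (t y)) commr_sign -mulrA (mulrA (t y)).
rewrite site_parity_creator !mulrA -exprD addnC; congr (_ * _ * _ * _).
by have [->|xy] := eqVneq x y; rewrite ?(negbTE ys) // addn0.
Qed.

Lemma parity_prod_site s x : uniq s -> parity_prod s * t x = t x * parity_prod s.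
Proof.
move=> us; rewrite /t mulrBr mulr1 mulrBl mul1r mulrnAr mulrnAl; congr (_ - _ *+ _).
rewrite /n mulrA parity_prod_creator // -!mulrA parity_prod_annihilator //.
by rewrite (mulrA (star (a x))) commr_sign !mulrA -signr_addb addbb mul1r.
Qed.

Lemma parity_prod_sq s : uniq s -> parity_prod s * parity_prod s = 1.
Proof.
elim: s => [|x s IHs] /=; first by rewrite /parity_prod big_nil mul1r.
move=> /andP[xs us]; have hs := parity_prod_site x us.
rewrite /parity_prod big_cons -/(parity_prod s) -{2}hs -mulrA (mulrA (parity_prod s)).
by rewrite IHs // mul1r site_parity_sq.
Qed.

Lemma star_parity_prod s : uniq s -> star (parity_prod s) = parity_prod s.
Proof.
elim: s => [|x s IHs] /=; first by rewrite /parity_prod big_nil star1.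
move=> /andP[xs us]; rewrite /parity_prod big_cons -/(parity_prod s) starM IHs //.
by rewrite star_site_parity parity_prod_site.
Qed.

(* Joint spectral decomposition of the commuting projections [n x]: a pair
   [(m, p)] records a spectral projection [p] of their sum and its eigenvalue. *)
Lemma number_spectral s : uniq s -> exists l : seq (nat * A),
  [/\ \sum_(p <- l) p.2 = 1,
      forall p, p \in l -> (\sum_(x <- s) n x) * p.2 = p.2 *+ p.1,
      \sum_(p <- l) (-1) ^+ p.1 * p.2 = parity_prod s
    & forall p y, p \in l -> y \notin s -> n y * p.2 = p.2 * n y].
Proof.
elim: s => [_|x s IHs /= /andP[xs us]].
  exists [:: (0%N, 1)]; split.
  - by rewrite big_seq1.
  - by move=> p; rewrite inE => /eqP ->; rewrite big_nil mul0r.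
  - by rewrite big_seq1 /parity_prod big_nil mul1r.
  - by move=> p y; rewrite inE => /eqP -> _; rewrite mul1r mulr1.
have [l [l1 lN lpar lC]] := IHs us.
(* Each projection splits according to whether the new site is empty, with the same eigenvalue, or
   occupied, with the eigenvalue raised by one. The last clause of the invariant lets [n x] pass
   through the old projections. *)
exists ([seq (p.1, p.2 * (1 - n x)) | p <- l] ++ [seq (p.1.+1, p.2 * n x) | p <- l]).
split.
- rewrite big_cat !big_map /= -!mulr_suml l1 !mul1r subrK //.
- move=> p; rewrite mem_cat big_cons mulrDl.
  case/orP => /mapP[[m q] ql -> /=]; have /= qC := lC _ x ql xs.
    move: (lN _ ql) (occupation_idem x) qC; move: (n x) (\sum_(y <- s) n y).
    move=> u N /= Nq uu uq; rewrite !mulrA Nq uq -mulrA mulrBr mulr1 uu subrr.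
    by rewrite mulr0 add0r mulrnAl.
  move: (lN _ ql) (occupation_idem x) qC; move: (n x) (\sum_(y <- s) n y).
  by move=> u N /= Nq uu uq; rewrite !mulrA Nq uq -mulrA uu mulrnAl -mulrS.
- rewrite big_cat !big_map /= /parity_prod big_cons -/(parity_prod s).
  rewrite -parity_prod_site // -lpar mulr_suml -big_split /=.
  apply: eq_bigr => -[m p] _ /=; rewrite exprS mulN1r mulNr -mulrBr -mulrBr /t.
  by rewrite mulr2n opprD addrA mulrA.
- move=> p y; rewrite mem_cat in_cons negb_or => + /andP[yx ys].
  case/orP => /mapP[[m q] ql -> /=]; have /= qC := lC _ y ql ys.
    move: (occupationC y x) qC; move: (n x) (n y) => u v vu vq.
    by rewrite mulrA vq -!mulrA mulrBr mulr1 mulrBl mul1r vu.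
  move: (occupationC y x) qC; move: (n x) (n y) => u v vu vq.
  by rewrite mulrA vq -!mulrA vu.
Qed.

(** On the spectral projection with eigenvalue $m$ the exponential series is the scalar series of
    $e^{i\pi m}=(-1)^m$. This replaces the analytic parity operator by an algebraic product. *)
Lemma parity_opE (X : {fset Gamma}) : parity_op a X = parity_prod X.
Proof.
have [l [l1 lN lpar _]] := number_spectral (fset_uniq X).
apply: cstar_expE.
pose c m k : R[i] := \sum_(0 <= j < k) ((j`!)%:R : R[i])^-1 * (0 +i* (m%:R * pi))%C ^+ j.
have -> : (fun k => \sum_(0 <= j < k) ((j`!)%:R : R[i])^-1 *:
    ((0 +i* pi)%C *: number_op a X) ^+ j) =
    (fun k => \sum_(p <- l) c p.1 k *: p.2).
  apply/funext => k.
  have pow j p : p \in l -> number_op a X ^+ j * p.2 = p.2 *+ (p.1 ^ j).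
    move=> pl; elim: j => [|j IHj]; first by rewrite expr0 mul1r.
    by rewrite exprS -mulrA IHj mulrnAr lN // -mulrnA expnS.
  (* Inserting the resolution of the identity [l1] turns each power of the number operator into
     scalars on the spectral projections. *)
  under eq_bigr => j _.
    rewrite exprZn scalerA -[number_op a X ^+ j]mulr1 -l1 mulr_sumr.
    rewrite scaler_sumr; under eq_big_seq => p pl do rewrite pow // -[p.2 *+ _]scaler_nat scalerA.
    over.
  rewrite exchange_big /=; apply: eq_big_seq => p pl; rewrite /c scaler_suml.
  apply: eq_bigr => j _; congr (_ *: _); rewrite -mulrA; congr (_ * _).
  rewrite natrX -exprMn; congr (_ ^+ _); apply/eqP.
  rewrite -(rmorph_nat (real_complex R)) eq_complex /=.
  by rewrite !mul0r !mulr0 subr0 ?addr0 ?add0r mulrC !eqxx.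
have -> : parity_prod X = \sum_(p <- l) (-1) ^+ p.1 *: p.2.
  rewrite -lpar; apply: eq_bigr => p _.
  by rewrite -signr_odd mulr_sign -(signr_odd R[i]) scaler_sign.
apply: (@cvg_big _ _ +%R 0 predT add_continuous _ _ l (fun p k => c p.1 k *: p.2)).
move=> [m p] _ /=; apply/cvg_cnormP => e e0.
have d0 : 0 < e / (cnorm p + 1) by rewrite divr_gt0 // ltr_wpDl ?cnorm_ge0.
have := imag_exp_cvg (m%:R * pi) d0; rewrite cos_natpi sin_natpi.
apply: filterS => k; rewrite -/(c m k).
have -> : ((-1) ^+ m +i* 0)%C = (-1) ^+ m :> R[i].
  by rewrite -[LHS]/(((-1) ^+ m)%:C%C) rmorphXn rmorphN1.
rewrite ltr_pdivlMr ?ltr_wpDl ?cnorm_ge0 // => h.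
rewrite -scalerBl cnormZ (le_lt_trans _ h) // ler_wpM2l ?normc_ge0 //.
by rewrite lerDl.
Qed.

(** The elements [b] obeying both relations form a C*-subalgebra, because parity is conjugation by a
    self-adjoint involution commuting with [a y] and its adjoint. It contains each generator [a x]:
    parity flips its sign, and it anticommutes with both operators at [y]. *)
Lemma graded_commute (X : {fset Gamma}) y b : local_alg a [set` X] b -> y \notin X ->
  a y * b = parity a X b * a y /\ star (a y) * b = parity a X b * star (a y).
Proof.
pose th := parity_prod X => bX yX; rewrite /parity parity_opE -/th.
have th2 : th * th = 1 by exact: (parity_prod_sq (fset_uniq X)).
have sth : star th = th by exact: (star_parity_prod (fset_uniq X)).
have tay : th * a y = a y * th.
  by rewrite parity_prod_annihilator ?fset_uniq // (negbTE yX) mul1r.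
have tsy : th * star (a y) = star (a y) * th.
  by rewrite parity_prod_creator ?fset_uniq // (negbTE yX) mul1r.
have tN1 : cnorm th = 1 by rewrite cnorm_unitary // /unitary sth th2.
pose f v b := v * b - th * b * th * v.
suff [/eqP h1 /eqP h2] : f (a y) b = 0 /\ f (star (a y)) b = 0.
  by move: h1 h2; rewrite !subr_eq0 => /eqP -> /eqP ->.
(* The star exchanges the two conditions, so it is their intersection that is closed under it. *)
apply: (bX ([set b1 | f (a y) b1 = 0] `&` [set b1 | f (star (a y)) b1 = 0])).
  have f1 v : th * v = v * th -> f v 1 = 0.
    by move=> tv; rewrite /f !mulr1 th2 mul1r subrr.
  have fD v b1 b2 : f v (b1 + b2) = f v b1 + f v b2.
    by rewrite /f !(mulrDr, mulrDl) opprD addrACA.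
  have fZ v (k : R[i]) b1 : f v (k *: b1) = k *: f v b1.
    by rewrite /f scalerBr -!(scalerAl, scalerAr).
  have fM v b1 b2 : f v b1 = 0 -> f v b2 = 0 -> f v (b1 * b2) = 0.
    rewrite /f => /eqP; rewrite subr_eq0 => /eqP h1 /eqP; rewrite subr_eq0 => /eqP h2.
    apply/eqP; rewrite subr_eq0 mulrA h1 -mulrA h2 !mulrA -(mulrA (th * b1)) th2.
    by rewrite mulr1.
  have fs v b1 : th * v = v * th -> f v b1 = 0 -> f (star v) (star b1) = 0.
    rewrite /f => tv /eqP; rewrite subr_eq0 => /eqP h1; apply/eqP.
    rewrite subr_eq0; apply/eqP.
    have /(congr1 (fun z => th * z * th)) := congr1 star h1.
    have tv' : th * star v = star v * th by rewrite -sth -!starM tv.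
    rewrite !starM sth => h2.
    move: h2; rewrite !mulrA tv' -(mulrA (star v) th th) th2 mulr1.
    rewrite -(mulrA _ th th) th2 mulr1 => <-.
    by rewrite -!mulrA tv'.
  have fcl v : closed [set b1 | f v b1 = 0].
    apply: (closed_bounded_kernel (C := cnorm v + cnorm v)) => [b1 b2|b1].
      by rewrite /f !(mulrBr, mulrBl) !opprB addrACA [RHS]addrACA [X in _ + X]addrC.
    rewrite /f (le_trans (cnormB _ _)) // mulrDl lerD ?cnormM //.
    rewrite -[X in _ <= _ * X]mul1r -[X in _ <= _ * X]mulr1 mulrC -!tN1.
    by rewrite !cnormM_le.
  split.
  - by split; apply: f1.
  - move=> b1 b2 [/= h1 h1'] [/= h2 h2']; split; split => /=;
      by rewrite ?fD ?h1 ?h2 ?h1' ?h2' ?addr0 // fM.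
  - by move=> k b1 [/= h1 h1']; split; rewrite /= fZ ?h1 ?h1' scaler0.
  - move=> b1 [/= h1 h1']; split => /=; last exact: fs.
    by rewrite -(starK (a y)) fs.
  - exact: closedI.
move=> _ [x /= xX <-].
have xy : x != y by apply: contraNneq yX => <-.
have tx : th * a x * th = - a x.
  rewrite parity_prod_annihilator ?fset_uniq // xX expr1 mulN1r mulNr.
  by rewrite -mulrA th2 mulr1.
split; rewrite /= /f tx mulNr opprK; first by rewrite (annihilatorC x y) addNr.
by rewrite annihilator_starC // subrr.
Qed.

(** The commutant of a self-adjoint [b] is a C*-subalgebra, and for even [b] it contains the
    generators over [Y] by [graded_commute]. The element [c] may be odd. *)
Lemma even_commute (X Y : {fset Gamma}) b c : even_alg a X b -> star b = b ->
  local_alg a [set` Y] c -> (X `&` Y = fset0)%fset -> b * c = c * b.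
Proof.
move=> [bX /= bpar] sb cY XY; apply/eqP; rewrite -subr_eq0; apply/eqP.
apply: (cY [set c | b * c - c * b = 0]).
  split.
  - by rewrite /= mulr1 mul1r subrr.
  - move=> c1 c2 /= /eqP; rewrite subr_eq0 => /eqP h1 /eqP.
    rewrite subr_eq0 => /eqP h2; split.
      by rewrite mulrDl mulrDr h1 h2 subrr.
    by rewrite mulrA h1 -mulrA h2 mulrA subrr.
  - by move=> k c1 /= h; rewrite -scalerAl -scalerAr -scalerBr h scaler0.
  - move=> c1 /= /(congr1 star); rewrite starB !starM sb star0 => /eqP.
    by rewrite subr_eq0 => /eqP ->; rewrite subrr.
  - apply: (closed_bounded_kernel (C := 2 * cnorm b)) => [c1 c2|c1].
      by rewrite mulrBr mulrBl !opprB addrACA [RHS]addrACA [X in _ + X]addrC.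
    rewrite (le_trans (cnormB _ _)) // mulr2n !mulrDl mul1r lerD ?cnormM //.
    by rewrite mulrC cnormM.
move=> _ [y /= yY <-].
have yX : y \notin X.
  apply/negP => yX; have : y \in (X `&` Y)%fset by rewrite in_fsetI yX.
  by rewrite XY.
by have [-> _] := graded_commute bX yX; rewrite bpar subrr.
Qed.

End CARParity.

(** * The dynamics over a short time step *)

Section DynamicsStep.
Variables (R : realType) (A : cstarAlgType R).
Implicit Types b c V H : A.

Lemma derivative_within_near (I : interval R) (f : R -> A) t l e :
  has_derivative_within I f t l -> 0 < e ->
  \forall u \near t^', u \in I ->
    cnorm (f u - f t - (u - t)%:C%C *: l) <= e * `|u - t|.
Proof.
move=> /cvg_cnormP h e0; have := h e e0.
rewrite near_withinE => hn; near=> u => uI.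
have ut : u - t != 0 by rewrite subr_eq0; near: u; exact: nbhs_dnbhs_neq.
have hh : cnorm ((u - t)^-1%:C%C *: (f u - f t) - l) < e.
  by move: uI; near: u; move: hn; apply: filterS => u; apply.
have -> : f u - f t - (u - t)%:C%C *: l =
    (u - t)%:C%C *: ((u - t)^-1%:C%C *: (f u - f t) - l).
  by rewrite scalerBr scalerA -rmorphM /= divff // scale1r.
by rewrite cnormZ normc_real mulrC ler_wpM2r // ltW.
Unshelve. all: by end_near. Qed.

(** The constant and first-order parts agree, so every remaining term carries at least two factors
    of [h]. *)
Lemma euler_sum h H0 H1 H2 :
  euler h H2 * (euler h H0 * euler h H1) - euler h (H0 + H1 + H2) =
  (0 +i* h)%C *: H2 * ((0 +i* h)%C *: H0) * euler h H1
  + (0 +i* h)%C *: (H2 + H0) * ((0 +i* h)%C *: H1).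
Proof.
rewrite /euler !scalerDr; set x0 := _ *: H0; set x1 := _ *: H1; set x2 := _ *: H2.
rewrite mulrA [(1 - x2) * _]mulrBr mulr1 [(1 - x2) * x0]mulrBl mul1r.
have -> : 1 - x2 - (x0 - x2 * x0) = x2 * x0 + (1 - (x2 + x0)).
  by rewrite opprB opprD !addrA; congr (_ - _); rewrite addrC addrA.
rewrite mulrDl -addrA; congr (_ + _); apply/eqP; rewrite subr_eq; apply/eqP.
have -> : x0 + x1 + x2 = x2 + x0 + x1 by rewrite addrC addrA.
move: (x2 + x0) => y; rewrite mulrBr mulr1 mulrBl mul1r opprB opprD !addrA.
by congr (_ - _); rewrite [LHS]addrC addrA.
Qed.

Lemma cnorm_euler_sum h H0 H1 H2 (nu : R) : 0 < h <= 1 ->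
  cnorm H0 <= nu -> cnorm H1 <= nu -> cnorm H2 <= nu ->
  cnorm (euler h H2 * (euler h H0 * euler h H1) - euler h (H0 + H1 + H2)) <=
  h * (h * nu ^+ 2 * (3 + nu)).
Proof.
move=> /andP[h0 h1] n0 n1 n2; rewrite euler_sum (le_trans (cnormD _ _)) //.
have nu0 : 0 <= nu := le_trans (cnorm_ge0 _) n0.
have nx H : cnorm H <= nu -> cnorm ((0 +i* h)%C *: H) <= h * nu.
  by move=> n; rewrite cnormZ normc_imag gtr0_norm // ler_pM2l.
have ne : cnorm (euler h H1) <= 1 + nu.
  rewrite (le_trans (cnorm_euler _ _)) // lerD2l gtr0_norm //.
  by rewrite -[leRHS]mul1r ler_pM // ?cnorm_ge0 // ltW.
have n20 : cnorm ((0 +i* h)%C *: (H2 + H0)) <= h * nu + h * nu.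
  by rewrite scalerDr (le_trans (cnormD _ _)) // lerD ?nx.
have -> : h * (h * nu ^+ 2 * (3 + nu)) =
  h * nu * (h * nu) * (1 + nu) + (h * nu + h * nu) * (h * nu) by ring.
by rewrite lerD // !cnormM_le // nx.
Qed.

Lemma conj_perturb b V V' (x y : R) :
  cnorm V <= x -> cnorm V' <= y ->
  cnorm (star V' * b * V' - star V * b * V) <= cnorm (V' - V) * (y + x) * cnorm b.
Proof.
move=> Vx Vy.
have -> : star V' * b * V' - star V * b * V =
    star (V' - V) * b * V' + star V * b * (V' - V).
  by rewrite starB !mulrBl mulrBr addrA subrK.
have -> : cnorm (V' - V) * (y + x) * cnorm b =
    cnorm (V' - V) * cnorm b * y + x * cnorm b * cnorm (V' - V) by ring.
by rewrite (le_trans (cnormD _ _)) // lerD // !cnormM_le ?cnorm_star.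
Qed.

Lemma cnorm_euler_conj h H b (nu : R) : star H = H -> cnorm H <= nu ->
  cnorm (star (euler h H) * b * euler h H) <= (1 + h ^+ 2 * nu ^+ 2) * cnorm b.
Proof.
move=> sH Hn; have nu0 : 0 <= nu := le_trans (cnorm_ge0 _) Hn.
apply: (le_trans (_ : _ <= cnorm (euler h H) ^+ 2 * cnorm b)).
  by rewrite expr2 mulrAC !cnormM_le ?cnorm_star.
rewrite ler_wpM2r ?cnorm_ge0 // (le_trans (cnorm_euler_sq _ _)) // lerD2l.
by rewrite ler_wpM2l ?sqr_ge0 // lerXn2r // ?nnegrE ?cnorm_ge0.
Qed.

(** The two correction terms in [gcomm_conj] contain ordinary commutators with [P] whatever [k] is;
    together they produce the factor 2 that ends up in the exponent. *)
Lemma gcomm_euler_conj k h P b c (nu : R) : ComplexField.Normc.normc k = 1 ->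
  0 < h -> star P = P -> cnorm P <= nu ->
  cnorm (gcomm k (star (euler h P) * b * euler h P) c) <=
  (1 + h ^+ 2 * nu ^+ 2) * cnorm (gcomm k b c)
  + h * (2 * (1 + h * nu) * cnorm b * cnorm (commutator P c)).
Proof.
move=> k1 h0 sP Pn; rewrite gcomm_conj.
have ne : cnorm (euler h P) <= 1 + h * nu.
  rewrite (le_trans (cnorm_euler _ _)) // lerD2l gtr0_norm //.
  by rewrite ler_pM2l.
have c1 : cnorm (commutator (euler h P) c) = h * cnorm (commutator P c).
  have -> : commutator (euler h P) c = - ((0 +i* h)%C *: commutator P c).
    rewrite /commutator /euler mulrBl mulrBr mul1r mulr1 -scalerAl -scalerAr.
    by rewrite opprB addrC addrA subrK -scalerBr -scalerN opprB.
  by rewrite cnormN cnormZ normc_imag gtr0_norm.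
have c2 : cnorm (commutator c (star (euler h P))) = h * cnorm (commutator P c).
  have -> : commutator c (star (euler h P)) = - ((0 +i* h)%C *: commutator P c).
    rewrite star_euler // /commutator mulrDl mulrDr mul1r mulr1 -scalerAl -scalerAr.
    by rewrite opprD addrACA subrr add0r -scalerBr -scalerN opprB.
  by rewrite cnormN cnormZ normc_imag gtr0_norm.
rewrite (le_trans (cnormB _ _)) // (le_trans (lerD (cnormD _ _) (lexx _))) //.
rewrite -addrA lerD //; first exact: cnorm_euler_conj.
rewrite cnormZ k1 mul1r.
have -> : h * (2 * (1 + h * nu) * cnorm b * cnorm (commutator P c)) =
  (1 + h * nu) * cnorm b * (h * cnorm (commutator P c)) +
  h * cnorm (commutator P c) * cnorm b * (1 + h * nu) by ring.
by rewrite lerD // !cnormM_le ?cnorm_star ?c1 ?c2.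
Qed.

(** One time step from [V] to [V']. The part [H0] only replaces [b] by a conjugate, [H1] contributes
    the first-order growth, and [H2] enters only through the error terms, since it commutes with
    [b]. *)
Lemma gcomm_step k V V' b c H0 H1 H2 (h e nu : R) :
  ComplexField.Normc.normc k = 1 -> unitary V -> unitary V' -> 0 < h <= 1 ->
  star H0 = H0 -> star H1 = H1 -> star H2 = H2 ->
  cnorm H0 <= nu -> cnorm H1 <= nu -> cnorm H2 <= nu ->
  cnorm (V' - euler h (H0 + H1 + H2) * V) <= e * h ->
  b * H2 = H2 * b ->
  cnorm (gcomm k (star V' * b * V') c) <=
  (1 + h ^+ 2 * nu ^+ 2) *
    cnorm (gcomm k (star V * (star (euler h H0) * b * euler h H0) * V) c)
  + h * (2 * (1 + h * nu) * cnorm (star (euler h H0) * b * euler h H0) *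
         cnorm (commutator (star V * H1 * V) c))
  + 2 * cnorm c * (h * ((e + h * nu ^+ 2 * (3 + nu)) * (1 + (1 + nu) ^+ 3)
                        + h * nu ^+ 2 * (1 + nu) ^+ 4) * cnorm b).
Proof.
move=> k1 uV uV' h01 s0 s1 s2 n0 n1 n2 hV' bH2.
have [h0 h1] := andP h01.
have nu0 : 0 <= nu := le_trans (cnorm_ge0 _) n0.
have [VV VV'] := uV; have nV := cnorm_unitary uV.
have ne H : cnorm H <= nu -> cnorm (euler h H) <= 1 + nu.
  move=> Hn; rewrite (le_trans (cnorm_euler _ _)) // lerD2l gtr0_norm //.
  by rewrite -[leRHS]mul1r ler_pM // ?cnorm_ge0 // ltW.
pose V0 := euler h H0 * euler h H1 * V; pose V1 := euler h H2 * V0.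
set b' := star (euler h H0) * b * euler h H0; set P := star V * H1 * V.
have nV0 : cnorm V0 <= (1 + nu) ^+ 2.
  by rewrite -[leRHS]mulr1 expr2 !cnormM_le ?ne ?nV.
have nV1 : cnorm V1 <= (1 + nu) ^+ 3.
  by rewrite exprS cnormM_le // ne.
have dV1 : cnorm (V' - V1) <= h * (e + h * nu ^+ 2 * (3 + nu)).
  have -> : V' - V1 = (V' - euler h (H0 + H1 + H2) * V) -
     (euler h H2 * (euler h H0 * euler h H1) - euler h (H0 + H1 + H2)) * V.
    by rewrite [(_ - euler _ _) * V]mulrBl opprB addrA subrK /V1 /V0 !mulrA.
  rewrite (le_trans (cnormB _ _)) // [h * (_ + _)]mulrDr lerD //; first by rewrite [h * e]mulrC.
  by rewrite -[leRHS]mulr1 cnormM_le ?nV // cnorm_euler_sum.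
have nV' : cnorm V' <= 1 by rewrite cnorm_unitary.
have E1 := conj_perturb b nV1 nV'.
(* Moving [V] outwards turns the factor of [H1] into the factor of its evolved version [P]. *)
have V0E : star V0 * b * V0 = star (euler h P) * (star V * b' * V) * euler h P.
  have VP : V * euler h P = euler h H1 * V.
    rewrite /P /euler mulrBr mulr1 mulrBl mul1r -scalerAr -scalerAl.
    by rewrite !mulrA VV' mul1r.
  have VPs : star (euler h P) * star V = star V * star (euler h H1).
    by rewrite -!starM VP.
  by rewrite /V0 !starM /b' !mulrA VPs -!mulrA VP.
have E2 : cnorm (star V1 * b * V1 - star V0 * b * V0) <=
    h * (h * nu ^+ 2 * (1 + nu) ^+ 4) * cnorm b.
  have -> : star V1 * b * V1 - star V0 * b * V0 =
      star V0 * ((h ^+ 2)%:C%C *: (H2 * H2) * b) * V0.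
    (* As [b] commutes with [H2], the two factors meet and [star_eulerM] leaves a second-order term
       only. *)
    have T2b : star (euler h H2) * b * euler h H2 = b + (h ^+ 2)%:C%C *: (H2 * H2) * b.
      have -> : star (euler h H2) * b * euler h H2 = star (euler h H2) * euler h H2 * b.
        rewrite -!mulrA; congr (_ * _).
        by rewrite /euler mulrBr mulrBl mulr1 mul1r -scalerAr -scalerAl bH2.
      by rewrite star_eulerM // mulrDl mul1r.
    have -> : star V1 * b * V1 = star V0 * (star (euler h H2) * b * euler h H2) * V0.
      by rewrite /V1 starM !mulrA.
    by rewrite T2b mulrDr mulrDl addrC addKr.
  have -> : h * (h * nu ^+ 2 * (1 + nu) ^+ 4) * cnorm b =
     (1 + nu) ^+ 2 * (h ^+ 2 * (nu * nu) * cnorm b) * (1 + nu) ^+ 2 by ring.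
  rewrite cnormM_le // cnormM_le ?cnorm_star // cnormM_le //.
  rewrite cnormZ normc_real ger0_norm ?sqr_ge0 //.
  by rewrite ler_wpM2l ?sqr_ge0 // cnormM_le.
have sP : star P = P by rewrite /P !starM starK s1 mulrA.
have nP : cnorm P <= nu.
  by rewrite -[nu]mulr1 -[nu]mul1r !cnormM_le // ?cnorm_star ?nV.
(* Telescoping through [V1]: the term with [V0] carries the dynamics, and the two differences are
   the errors [E1] and [E2]. *)
have -> : star V' * b * V' = star V0 * b * V0 +
   ((star V' * b * V' - star V1 * b * V1) + (star V1 * b * V1 - star V0 * b * V0)).
  by rewrite [_ - _ + (_ - _)]addrA subrK [RHS]addrC subrK.
rewrite gcommDl (le_trans (cnormD _ _)) //; apply: lerD.
  rewrite V0E (le_trans (gcomm_euler_conj _ _ k1 h0 sP nP)) // lerD2l.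
  rewrite ler_wpM2l ?(ltW h0) // ler_wpM2r ?cnorm_ge0 // ler_wpM2l //.
    by rewrite mulr_ge0 // addr_ge0 // mulr_ge0 // ltW.
  by rewrite -[leRHS]mulr1 -[cnorm b']mul1r !cnormM_le ?cnorm_star ?nV.
rewrite (le_trans (cnorm_gcomm _ _ k1)) // ler_wpM2l ?mulr_ge0 ?cnorm_ge0 //.
rewrite (le_trans (cnormD _ _)) // [h * (_ + _)]mulrDr mulrDl lerD //.
rewrite (le_trans E1) // ler_wpM2r ?cnorm_ge0 // mulrA ler_wpM2r //.
by rewrite addr_ge0 // exprn_ge0 // addr_ge0.
Qed.

End DynamicsStep.

Lemma step_asymptotics (R : realType) (M p be nu K1 K2 e1 : R) :
  0 <= M -> 0 <= p -> 0 <= be -> 0 <= nu -> 0 <= K1 -> 0 <= K2 -> 0 < e1 ->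
  exists e, 0 < e /\ exists d, 0 < d /\ forall h, 0 < h -> h < d -> h <= 1 /\
    (1 + h ^+ 2 * nu ^+ 2) * (M * (1 + h ^+ 2 * nu ^+ 2))
    + h * (2 * (1 + h * nu) * (1 + h ^+ 2 * nu ^+ 2) * p)
    + 2 * be * (h * ((e + h * nu ^+ 2 * (3 + nu)) * K1 + h * nu ^+ 2 * K2))
    <= M + h * (2 * p + e1).
Proof.
move=> M0 p0 be0 nu0 K10 K20 e10.
(* [Q] is the coefficient [B] below with [h] set to 1, hence a bound for it on small steps. The
   choices of [e] and of the step bound each spend half of [e1]. *)
pose Q := M * (2 * nu ^+ 2 + nu ^+ 4) + 2 * p * (nu + nu ^+ 2 + nu ^+ 3)
  + 2 * be * (nu ^+ 2 * (3 + nu) * K1 + nu ^+ 2 * K2).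
have Q0 : 0 <= Q.
  by rewrite !addr_ge0 // !mulr_ge0 // ?addr_ge0 // ?mulr_ge0 ?exprn_ge0 // ?addr_ge0.
have b1 : 0 < 2 * (1 + 2 * be * K1) by rewrite mulr_gt0 // ltr_pwDl // !mulr_ge0.
have Q1 : 0 < 2 * (1 + Q) by rewrite mulr_gt0 // ltr_pwDl.
exists (e1 / (2 * (1 + 2 * be * K1))); split; first by rewrite divr_gt0.
exists (Num.min 1 (e1 / (2 * (1 + Q)))); split.
  by rewrite lt_min ltr01 divr_gt0.
set e := e1 / (2 * (1 + 2 * be * K1)) => h h0; rewrite lt_min => /andP[h1 hQ]; split; first exact: ltW.
have he : 2 * be * K1 * e <= e1 / 2.
  have : e * (2 * (1 + 2 * be * K1)) = e1 by rewrite /e divfK ?gt_eqF.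
  have : 0 <= e by rewrite /e divr_ge0 // ltW.
  by nra.
have hQ' : h * Q <= e1 / 2.
  by move: hQ; rewrite ltr_pdivlMr // => hQ; nra.
have hh : h ^+ 2 <= h by rewrite expr2 ger_pMl // ltW.
have h2 : h ^+ 2 <= 1 by rewrite exprn_ile1 // ltW.
pose B := M * (2 * nu ^+ 2 + h ^+ 2 * nu ^+ 4)
  + 2 * p * (nu + h * nu ^+ 2 + h ^+ 2 * nu ^+ 3)
  + 2 * be * (nu ^+ 2 * (3 + nu) * K1 + nu ^+ 2 * K2).
have BQ : B <= Q.
  rewrite /B /Q lerD2r lerD //.
    by rewrite ler_wpM2l // lerD2l ler_piMl // exprn_ge0.
  by rewrite ler_wpM2l ?mulr_ge0 // -!addrA lerD2l lerD // ler_piMl ?exprn_ge0 // ltW.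
have -> : (1 + h ^+ 2 * nu ^+ 2) * (M * (1 + h ^+ 2 * nu ^+ 2))
    + h * (2 * (1 + h * nu) * (1 + h ^+ 2 * nu ^+ 2) * p)
    + 2 * be * (h * ((e + h * nu ^+ 2 * (3 + nu)) * K1 + h * nu ^+ 2 * K2)) =
    M + h * (2 * p + (2 * be * K1 * e + h * B)) by rewrite /B; ring.
rewrite lerD2l ler_pM2l // lerD2l [leRHS]splitr lerD //.
by rewrite (le_trans _ hQ') // ler_pM2l.
Qed.

(** * One-sided estimates of the evolved graded commutator at a fixed time *)

Section DynamicsNear.
Variables (R : realType) (A : cstarAlgType R) (I : interval R) (V : R -> A).
Hypothesis uV : forall u, u \in I -> unitary (V u).
Implicit Types b c H : A.

(** A one-sided differential inequality with rate [2 * p]. The neighbourhood of [r] is chosen before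
    [k] and [b], so the estimate is uniform over the class [K]. *)
Lemma gcomm_near r H0 H1 H2 c (K : R[i] -> set A) (M p e1 : R) :
  r \in I ->
  has_derivative_within I V r (- ((0 +i* 1)%C *: ((H0 + H1 + H2) * V r))) ->
  star H0 = H0 -> star H1 = H1 -> star H2 = H2 ->
  (forall k b, K k b -> [/\ ComplexField.Normc.normc k = 1, b * H2 = H2 * b,
     cnorm (gcomm k (star (V r) * b * V r) c) <= M * cnorm b
     & forall h, K k (star (euler h H0) * b * euler h H0)]) ->
  cnorm (commutator (star (V r) * H1 * V r) c) <= p -> 0 <= M -> 0 < e1 ->
  \forall u \near r^'+, u \in I -> forall k b, K k b ->
    cnorm (gcomm k (star (V u) * b * V u) c) <=
    (M + (u - r) * (2 * p + e1)) * cnorm b.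
Proof.
move=> rI dV s0 s1 s2 KP pP M0 e10.
pose nu := cnorm H0 + cnorm H1 + cnorm H2.
have n0 : cnorm H0 <= nu by rewrite /nu -addrA lerDl addr_ge0 // cnorm_ge0.
have n1 : cnorm H1 <= nu by rewrite /nu addrAC lerDr addr_ge0 // cnorm_ge0.
have n2 : cnorm H2 <= nu by rewrite /nu lerDr addr_ge0 // cnorm_ge0.
have nu0 : 0 <= nu := le_trans (cnorm_ge0 _) n0.
have p0 : 0 <= p := le_trans (cnorm_ge0 _) pP.
have K10 : 0 <= 1 + (1 + nu) ^+ 3 by rewrite addr_ge0 // exprn_ge0 // addr_ge0.
have K20 : 0 <= (1 + nu) ^+ 4 by rewrite exprn_ge0 // addr_ge0.
have [e [e0 [d [d0 asym]]]] :=
  step_asymptotics M0 p0 (cnorm_ge0 c) nu0 K10 K20 e10.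
have dn : \forall u \near r^'+, u \in I ->
    cnorm (V u - euler (u - r) (H0 + H1 + H2) * V r) <= e * (u - r).
  have := derivative_within_near dV e0; rewrite !near_withinE.
  apply: filterS => u h ru uI.
  have ur : u != r by rewrite gt_eqF.
  have := h ur uI; rewrite gtr0_norm ?subr_gt0 //; congr (cnorm _ <= _).
  rewrite /euler mulrBl mul1r opprB addrA addrAC scalerN opprK -scalerAl scalerA.
  congr (_ + _ *: _); apply/eqP; rewrite eq_complex /=.
  by rewrite !mulr0 !mul0r !mulr1 subr0 addr0 !eqxx.
near=> u => uI k b Kb.
have ru : 0 < u - r by rewrite subr_gt0; near: u; exact: nbhs_right_gt.
have ud : u - r < d.
  rewrite ltrBlDl; near: u; apply: nbhs_right_lt; by rewrite ltrDl.
have [k1 bH2 bM bK] := KP _ _ Kb.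
have [h1 ha] := asym _ ru ud.
have hd : cnorm (V u - euler (u - r) (H0 + H1 + H2) * V r) <= e * (u - r).
  by move: uI; near: u; exact: dn.
have h01 : 0 < u - r <= 1 by rewrite ru.
apply: le_trans (gcomm_step c k1 (uV rI) (uV uI) h01 s0 s1 s2 n0 n1 n2 hd bH2) _.
(* Stability of [K] makes the bound at time [r] available for the conjugated observable. *)
have [_ _ bM' _] := KP _ _ (bK (u - r)).
have nb' := cnorm_euler_conj (u - r) b s0 n0.
apply: le_trans (ler_wpM2r (cnorm_ge0 b) ha).
rewrite [leRHS]mulrDl [X in _ <= X + _]mulrDl.
set h := u - r in ru h1 ud hd h01 bM' nb' ha *; have h0 := ltW ru.
have s0' : 0 <= 1 + h ^+ 2 * nu ^+ 2 by rewrite addr_ge0 // mulr_ge0 // exprn_ge0.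
have t0' : 0 <= 2 * (1 + h * nu) by rewrite mulr_ge0 // addr_ge0 // mulr_ge0.
apply: lerD; last by rewrite -[leRHS]mulrA.
apply: lerD.
  rewrite -[leRHS]mulrA ler_wpM2l // (le_trans bM') //.
  by rewrite -[leRHS]mulrA ler_wpM2l.
rewrite -[leRHS]mulrA ler_wpM2l //.
have -> : 2 * (1 + h * nu) * (1 + h ^+ 2 * nu ^+ 2) * p * cnorm b =
  2 * (1 + h * nu) * ((1 + h ^+ 2 * nu ^+ 2) * cnorm b) * p by ring.
apply: ler_pM => //; [|exact: cnorm_ge0|exact: ler_wpM2l].
by apply: mulr_ge0 => //; exact: cnorm_ge0.
Unshelve. all: by end_near. Qed.

(** Differentiability gives [cnorm (V u - V r) <= (1 + cnorm l) * (r - u)] near [r]; the error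
    scales with [cnorm b], so one neighbourhood serves all [k] and [b]. *)
Lemma gcomm_left r l c (e : R) : r \in I -> has_derivative_within I V r l -> 0 < e ->
  \forall u \near r^'-, u \in I -> forall k b, ComplexField.Normc.normc k = 1 ->
    cnorm (gcomm k (star (V r) * b * V r) c) <=
    cnorm (gcomm k (star (V u) * b * V u) c) + e * cnorm b.
Proof.
move=> rI dV e0.
have dn : \forall u \near r^'-, u \in I ->
    cnorm (V u - V r) <= (1 + cnorm l) * (r - u).
  have := derivative_within_near dV ltr01; rewrite !near_withinE.
  apply: filterS => u h ru uI.
  have ur : u != r by rewrite lt_eqF.
  have := h ur uI; rewrite mul1r ltr0_norm ?subr_lt0 // opprB => hu.
  rewrite -(subrK ((u - r)%:C%C *: l) (V u - V r)) (le_trans (cnormD _ _)) //.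
  rewrite mulrDl mul1r lerD // cnormZ normc_real ltr0_norm ?subr_lt0 // opprB.
  by rewrite mulrC.
pose C := 2 * cnorm c * ((1 + cnorm l) * 2).
have C0 : 0 <= C by rewrite !mulr_ge0 ?addr_ge0 ?cnorm_ge0.
near=> u => uI k b k1.
have ru : 0 < r - u by rewrite subr_gt0; near: u; exact: nbhs_left_lt.
have ud : r - u < e / (C + 1).
  rewrite ltrBlDr -ltrBlDl; near: u; apply: nbhs_left_gt.
  by rewrite ltrBlDl ltrDr divr_gt0 // ltr_wpDl.
have hd : cnorm (V u - V r) <= (1 + cnorm l) * (r - u).
  by move: uI; near: u; exact: dn.
have -> : star (V r) * b * V r = star (V u) * b * V u +
    (star (V r) * b * V r - star (V u) * b * V u) by rewrite addrC subrK.
rewrite gcommDl (le_trans (cnormD _ _)) // lerD2l (le_trans (cnorm_gcomm _ _ k1)) //.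
have nV w : w \in I -> cnorm (V w) <= 1 by move=> wI; rewrite (cnorm_unitary (uV wI)).
apply: (le_trans (_ : _ <= C * (r - u) * cnorm b)).
  have -> : C * (r - u) * cnorm b =
      2 * cnorm c * ((1 + cnorm l) * (r - u) * (1 + 1) * cnorm b).
    by rewrite /C; ring.
  apply: ler_wpM2l; first by rewrite mulr_ge0 // cnorm_ge0.
  apply: le_trans (conj_perturb b (nV _ uI) (nV _ rI)) _; rewrite cnorm_subC.
  by apply: ler_wpM2r; [exact: cnorm_ge0|exact: ler_wpM2r].
rewrite ler_wpM2r ?cnorm_ge0 //; move: ud; rewrite ltr_pdivlMr ?ltr_wpDl // => ud.
by rewrite (le_trans _ (ltW ud)) // mulrC ler_pM2l // lerDl.
Unshelve. all: by end_near. Qed.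


End DynamicsNear.

(** * Continuous induction, finite sums and integrals *)

Section RealInduction.
Variable R : realType.

Lemma near_rightP (r : R) (P : set R) : (\forall u \near r^'+, P u) ->
  exists2 e, 0 < e & forall u, r < u < r + e -> P u.
Proof.
rewrite near_withinE => /nbhs_ballP[e /= e0 he]; exists e => // u /andP[ru ue].
apply: he => //=; rewrite /ball /= distrC gtr0_norm ?subr_gt0 //.
by rewrite ltrBlDl.
Qed.

Lemma near_left_exists (r l : R) (P : set R) : (\forall u \near r^'-, P u) ->
  l < r -> exists2 u, l < u < r & P u.
Proof.
move=> h lr; have : \forall u \near r^'-, l < u < r /\ P u.
  near=> u; split; last by near: u; exact: h.
  apply/andP; split; near: u; [exact: nbhs_left_gt|exact: nbhs_left_lt].
by move=> /filter_ex[u [hu Pu]]; exists u.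
Unshelve. all: by end_near. Qed.

(** Take the supremum of the times up to which [D] holds throughout. The left hypothesis puts [D] at
    the supremum, and the right one would push past it if it were below [t]. *)
Lemma real_induction (D : R -> Prop) (s t : R) : s <= t -> D s ->
  (forall r, s <= r < t -> D r -> \forall u \near r^'+, u <= t -> D u) ->
  (forall r, s < r <= t -> (forall u, s <= u < r -> D u) -> D r) ->
  D t.
Proof.
move=> st Ds Dr Dl.
pose S := [set r | s <= r <= t /\ forall u, s <= u <= r -> D u].
have Ss : S s.
  split; first by rewrite lexx.
  by move=> u us; have -> : u = s by apply/eqP; rewrite eq_le andbC.
have Sub : ubound S t by move=> r [/andP[]].
have hS : has_sup S by split; [exists s|exists t].
have sb : s <= sup S by exact: ub_le_sup hS.2 _ Ss.
have bt : sup S <= t by apply: ge_sup => //; exists s.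
have below u : s <= u < sup S -> D u.
  case/andP => su ub; have e0 : 0 < sup S - u by rewrite subr_gt0.
  have [r [_ Sr]] := sup_adherent e0 hS; rewrite subKr => ur.
  by apply: Sr; rewrite su ltW.
have Db : D (sup S).
  move: sb; rewrite le_eqVlt => /predU1P[<- //|sb'].
  by apply: Dl => //; rewrite sb' bt.
move: (bt); rewrite le_eqVlt => /predU1P[<- //|bt'].
have [|e e0 he] := near_rightP (Dr (sup S) _ Db); first by rewrite sb bt'.
have m0 : sup S < Num.min t (sup S + e / 2).
  by rewrite lt_min bt' ltrDl divr_gt0.
suff Sm : S (Num.min t (sup S + e / 2)).
  by have := ub_le_sup hS.2 Sm; rewrite leNgt m0.
split; first by rewrite ge_min lexx (le_trans sb (ltW m0)).
move=> u /andP[su]; rewrite le_min => /andP[ut ue].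
have [ub|] := ltP u (sup S); first by apply: below; rewrite su.
rewrite le_eqVlt => /predU1P[<- //|bu]; apply: he => //.
by rewrite bu (le_lt_trans ue) // ltrD2l ltr_pdivrMr // ltr_pMr // ltr1n.
Qed.

End RealInduction.

Section FiniteSums.
Variables (R : realType) (T : choiceType).

Lemma sum_le_esum (S : set T) (f : T -> R) (F : {fset T}) (P : pred T) (M : R) :
  (forall i, i \in F -> P i -> S i) -> (\esum_(i in S) (f i)%:E <= M%:E)%E ->
  \sum_(i <- F | P i) f i <= M.
Proof.
move=> FS h; rewrite -lee_fin -sumEFin (le_trans _ h) // big_fset_condE.
rewrite fsbig_seq ?fset_uniq //; apply: esum_ge; eexists; last exact: lexx.
split; first exact: finite_fset.
by move=> i /=; rewrite !inE /= => /andP[]; exact: FS.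
Qed.

(** The witness is the maximum of 0 and the listed values; being one of these numbers, it inherits
    [P]. *)
Lemma seq_majorant (s : seq T) (g : T -> R) (P : R -> Prop) : P 0 ->
  (forall i, i \in s -> P (g i)) ->
  exists k, [/\ 0 <= k, P k & forall i, i \in s -> g i <= k].
Proof.
move=> P0; elim: s => [_|i s IHs Ps]; first by exists 0; split.
have [j js|k [k0 Pk ks]] := IHs; first by apply: Ps; rewrite in_cons js orbT.
have [ik|ki] := leP (g i) k.
  by exists k; split=> // j; rewrite in_cons => /predU1P[->//|/ks].
exists (g i); split; first exact: le_trans k0 (ltW ki).
  by apply: Ps; rewrite mem_head.
move=> j; rewrite in_cons => /predU1P[->//|/ks h].
exact: le_trans h (ltW ki).
Qed.

End FiniteSums.

Section IntervalIntegral.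
Variables (R : realType) (I : interval R) (f : R -> R) (s : R).
Hypothesis If : loc_integrable I f.
Hypothesis sI : s \in I.
Local Notation mu := (@lebesgue_measure R).
Let P t := \int[mu]_(r in `[s, t]) f r.

Lemma interval_sub (r u : R) : r \in I -> u \in I -> [set` `[r, u]] `<=` [set` I].
Proof.
move=> rI uI v /=; rewrite in_itv /= => rvu.
exact: (@interval_is_interval _ I r u rI uI v rvu).
Qed.

Lemma integral_increment r u k : s <= r -> r <= u -> u \in I ->
  (forall v, r < v <= u -> k <= f v) -> (u - r) * k <= P u - P r.
Proof.
move=> sr ru uI kf.
have rI : r \in I by apply: (interval_sub sI uI); rewrite /= in_itv /= sr.
have int a b : a \in I -> b \in I -> mu.-integrable `[a, b] (EFin \o f).
  by move=> aI bI; apply: If; [exact: segment_compact|exact: interval_sub].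
(* The increment is an integral over the half-open interval, which matches the absence of a lower
   bound for [f] at [r] itself. *)
rewrite /P Rintegral_itvB ?bnd_simp //; last exact: int.
have sub : [set` `]r, u]] `<=` [set` `[r, u]] by apply: subset_itvr; rewrite bnd_simp.
apply: (le_trans (_ : _ <= \int[mu]_(v in `]r, u]) k)).
  rewrite Rintegral_cst //= lebesgue_measure_itv /= lte_fin.
  case: ltP => [_|ur]; first by rewrite -EFinB /= mulrC.
  by rewrite mulr0 /=; have -> : r = u; [by apply/eqP; rewrite eq_le ru|rewrite subrr mul0r].
apply: le_Rintegral => //.
- suff h : mu.-integrable `[r, u] (EFin \o cst k) by exact: integrableS h.
  apply: continuous_compact_integrable; first exact: segment_compact.
  by apply: continuous_subspaceT => x; exact: cst_continuous.
- by apply: integrableS (int _ _ rI uI).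
Qed.

End IntervalIntegral.

(** * Sums over surface sets and the convolution inequality *)

Section BoundarySums.
Variables (R : realType) (T : choiceType).
Implicit Types (D L X Y W : {fset T}) (F : T -> R).

Lemma ler_sum_fsubset D L F : (D `<=` L)%fset -> (forall x, x \in L -> 0 <= F x) ->
  \sum_(x <- D) F x <= \sum_(x <- L) F x.
Proof.
move=> DL F0; have -> : D = [fset x in L | x \in D]%fset.
  apply/fsetP => x; rewrite !inE /=; apply/idP/andP => [xD|[]//].
  by rewrite (fsubsetP DL).
rewrite big_fset /= big_mkcond big_seq [leRHS]big_seq; apply: ler_sum => x xL.
by case: ifP => // _; exact: F0.
Qed.

Lemma ler_term_sum (s : seq T) (P : pred T) F x : x \in s -> P x ->
  (forall y, 0 <= F y) -> F x <= \sum_(y <- s | P y) F y.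
Proof. by move=> xs Px F0; rewrite (big_rem x) //= Px lerDl sumr_ge0. Qed.

Variables (L : {fset T}) (N : {fset T} -> R) (G : T -> T -> R) (k : R).
Hypothesis N0 : forall W, 0 <= N W.
Hypothesis G0 : forall x y, 0 <= G x y.
Hypothesis NG : forall x y, x \in L -> y \in L ->
  \sum_(W <- fpowerset L | (x \in W) && (y \in W)) N W <= k * G x y.

(** After exchanging the sums, the inner one runs over the sets containing both [x] and [v], which
    [NG] bounds. *)
Lemma cover_sum X F x : x \in L -> (X `<=` L)%fset -> (forall v, 0 <= F v) ->
  \sum_(W <- fpowerset L | x \in W) N W * (\sum_(v <- X | v \in W) F v) <=
  k * \sum_(v <- X) G x v * F v.
Proof.
move=> xL XL F0; under eq_bigr => W _ do rewrite mulr_sumr.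
rewrite (exchange_big_dep xpredT) //= mulr_sumr big_seq [leRHS]big_seq.
apply: ler_sum => v vX; rewrite -mulr_suml mulrA ler_wpM2r //.
by apply: NG => //; rewrite (fsubsetP XL).
Qed.

Hypothesis GG : forall x y, \sum_(z <- L) G x z * G z y <= G x y.
Hypothesis k0 : 0 <= k.
Variables (D Y : {fset T}) (surf : pred {fset T}) (S : {fset T} -> R) (be E q : R).
Let w x := \sum_(y <- Y) G x y.
Hypotheses (DL : (D `<=` L)%fset) (YL : (Y `<=` L)%fset).
Hypotheses (be0 : 0 <= be) (E1 : 1 <= E) (q0 : 0 <= q).
Hypothesis S0 : forall W, 0 <= S W.
Hypothesis Sw : forall W, (W `<=` L)%fset -> S W <= \sum_(v <- L | v \in W) w v.
Hypothesis surfD : forall W, W \in fpowerset L -> surf W -> N W != 0 ->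
  exists2 x, x \in D & x \in W.

(* Each set contributing to the sum meets [D]; summing over the meeting point
   and using the two convolution inequalities closes the Gronwall loop. *)
Lemma boundary_sum :
  \sum_(W <- fpowerset L | surf W)
     N W * (be * ((W `&` Y)%fset != fset0)%:R + be * (E - 1) * S W + q) <=
  k * (be * E * (\sum_(x <- D) w x) + q * \sum_(x <- L) G x x).
Proof.
have w0 x : 0 <= w x by apply: sumr_ge0.
have E0 : 0 <= E - 1 by rewrite subr_ge0.
set f := fun W => be * ((W `&` Y)%fset != fset0)%:R + be * (E - 1) * S W + q.
have f0 W : 0 <= f W by rewrite /f !addr_ge0 // !mulr_ge0.
apply: (le_trans (_ : _ <=
  \sum_(W <- fpowerset L) \sum_(x <- D | x \in W) N W * f W)).
  rewrite big_mkcond big_seq [leRHS]big_seq; apply: ler_sum => W WL.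
  case: ifP => [sW|_]; last by apply: sumr_ge0 => x _; rewrite mulr_ge0.
  have [->|NW] := eqVneq (N W) 0.
    by rewrite mul0r sumr_ge0.
  have [x xD xW] := surfD WL sW NW.
  by apply: (ler_term_sum (F := fun=> N W * f W) xD) => // _; rewrite mulr_ge0.
rewrite (exchange_big_dep xpredT) //=.
have step x : x \in L -> \sum_(W <- fpowerset L | x \in W) N W * f W <=
    k * (be * E * w x + q * G x x).
  move=> xL.
  apply: (le_trans (_ : _ <= \sum_(W <- fpowerset L | x \in W)
     (be * (N W * \sum_(y <- Y | y \in W) 1) +
      be * (E - 1) * (N W * \sum_(v <- L | v \in W) w v) + q * N W))).
    rewrite big_seq_cond [leRHS]big_seq_cond; apply: ler_sum => W /andP[WL _].
    rewrite /f; set m := _%:R; set m' := \sum_(_ <- Y | _) 1.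
    (* The indicator is at most the number of points of [Y] in [W], a form that [cover_sum] can
       handle. *)
    have mm : m <= m'.
      rewrite /m; case: (fset_0Vmem (W `&` Y)%fset) => [->|[y]].
        by rewrite eqxx; apply: sumr_ge0.
      move=> yWY; have := yWY; rewrite in_fsetI => /andP[yW yY].
      have -> : (W `&` Y)%fset != fset0 by apply/fset0Pn; exists y.
      exact: (ler_term_sum (F := fun=> 1) yY yW (fun=> ler01)).
    have -> : be * (N W * m') + be * (E - 1) * (N W * \sum_(v <- L | v \in W) w v)
       + q * N W = N W * (be * m' + be * (E - 1) * (\sum_(v <- L | v \in W) w v) + q)
      by ring.
    rewrite ler_wpM2l // lerD2r lerD // ler_wpM2l ?mulr_ge0 //.
    by apply: Sw; rewrite -fpowersetE.
  rewrite !big_split /= -!mulr_sumr.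
  (* Sets hitting [Y] give [be] and the convolution inequality gives [be * (E - 1)]; their sum
     [be * E] is what makes an exponential solve the inequality. *)
  have -> : k * (be * E * w x + q * G x x) =
    be * (k * w x) + be * (E - 1) * (k * w x) + q * (k * G x x) by ring.
  apply: lerD; first apply: lerD.
  - rewrite ler_wpM2l // (le_trans (cover_sum xL YL _)) // ler_wpM2l //.
    by apply: ler_sum => y _; rewrite mulr1.
  - rewrite ler_wpM2l ?mulr_ge0 // (le_trans (cover_sum xL _ _)) ?fsubset_refl //.
    rewrite ler_wpM2l //; under eq_bigr => v _ do rewrite mulr_sumr.
    by rewrite exchange_big /=; apply: ler_sum => y _; exact: GG.
  (* The diagonal case of [NG] controls the constant term. *)
  - rewrite ler_wpM2l //; under eq_bigl => W do rewrite -[x \in W]andbb.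
    exact: NG.
apply: (le_trans (_ : _ <= \sum_(x <- D) k * (be * E * w x + q * G x x))).
  rewrite big_seq [leRHS]big_seq; apply: ler_sum => x xD.
  by apply: step; rewrite (fsubsetP DL).
rewrite -mulr_sumr ler_wpM2l // big_split /= -!mulr_sumr lerD2l ler_wpM2l //.
exact: ler_sum_fsubset.
Qed.

End BoundarySums.

(** * Propagation estimate *)

Section LiebRobinson.
Variables (R : realType) (A : cstarAlgType R) (Gamma : countType).
Variables (G : Gamma -> Gamma -> R) (I : interval R) (Phi : {fset Gamma} -> R -> A).
Variables (phiG : R -> R) (L Y : {fset Gamma}) (V : R -> A) (c : A) (s : R).
Implicit Types (W X Z : {fset Gamma}) (b : A) (r t u : R) (k : R[i]).

Hypothesis G0 : forall x y, 0 < G x y.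
Hypothesis GG : forall x y, \sum_(z <- L) G x z * G z y <= G x y.
Hypothesis starPhi : forall X t, t \in I -> star (Phi X t) = Phi X t.
Hypothesis PhiC : forall X X' t t', t \in I -> t' \in I ->
  (X `&` X' = fset0)%fset -> Phi X t * Phi X' t' = Phi X' t' * Phi X t.
Hypothesis Phi_c : forall X t, t \in I -> (X `&` Y = fset0)%fset ->
  Phi X t * c = c * Phi X t.
Hypothesis Phi_cont : forall X, {within [set` I], continuous (Phi X)}.
Hypothesis phiG_int : loc_integrable I phiG.
Hypothesis phiG0 : forall t, t \in I -> 0 <= phiG t.
Hypothesis PhiG : forall x y t, t \in I ->
  \sum_(W <- fpowerset L | (x \in W) && (y \in W)) cnorm (Phi W t) <= phiG t * G x y.
Hypothesis sI : s \in I.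
Hypothesis YL : (Y `<=` L)%fset.
Hypothesis uV : forall t, t \in I -> unitary (V t).
Hypothesis V1 : V s = 1.
Hypothesis dV : forall t, t \in I -> has_derivative_within I V t
  (- ((0 +i* 1)%C *: (hamiltonian Phi L t * V t))).

Let P t := \int[@lebesgue_measure R]_(r in `[s, t]) phiG r.
Let w x := \sum_(y <- Y) G x y.
Let S Z := \sum_(x <- Phi_boundary I Phi Z) w x.
(** Bounds the rate at which surface terms feed the slack back into itself, by the last term of
    [boundary_sum]. *)
Let g := \sum_(x <- L) G x x.

(* The extra term in [majorant] makes the differential inequality it satisfies
   strict; [eps] tends to [0] at the end. *)
Let slack eps t := eps * expR (2 * g * P t + (t - s)).
Let majorant eps Z t :=
  2 * cnorm c * (expR (2 * P t) - 1) * S Z + slack eps t.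

(* The elements with the commutation relations of observables in [Z]: this class
   is stable under conjugation by the interactions inside [Z]. *)
Definition observable_in k Z b := [/\ ComplexField.Normc.normc k = 1,
  forall W t, t \in I -> (W `&` Z = fset0)%fset -> b * Phi W t = Phi W t * b
  & gcomm k b c = 0].

(** All regions are treated simultaneously because the surface terms of one region are observables
    in other regions. *)
Let bounded_at eps t := forall k Z b, (Z `<=` L)%fset -> (Z `&` Y = fset0)%fset ->
  observable_in k Z b ->
  cnorm (gcomm k (star (V t) * b * V t) c) <= majorant eps Z t * cnorm b.

(** [phiG] need not be continuous, so its value at [r] says nothing about its integral just after
    [r]. Instead [kr] is the largest ratio of an interaction sum to [G] at time [r]; these finitely
    many ratios are continuous in time and dominated by [phiG]. *)
Lemma PhiG_right r : r \in I -> exists kr, [/\ 0 <= kr,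
  forall x y, x \in L -> y \in L ->
    \sum_(W <- fpowerset L | (x \in W) && (y \in W)) cnorm (Phi W r) <= kr * G x y
  & forall e, 0 < e -> \forall u \near r^'+, u \in I -> kr - e <= phiG u].
Proof.
move=> rI; pose T x y u :=
  \sum_(W <- fpowerset L | (x \in W) && (y \in W)) cnorm (Phi W u).
have := @seq_majorant R _ [seq (x, y) | x <- L, y <- L]
  (fun xy => T xy.1 xy.2 r / G xy.1 xy.2)
  (fun kr : R => forall e : R, 0 < e -> \forall u \near r^'+, u \in I -> kr - e <= phiG u).
case.
- move=> e e0; near=> u => uI; rewrite (le_trans _ (phiG0 uI)) // sub0r oppr_le0.
  exact: ltW.
- move=> [x y] _ /= e e0.
  have Nc W : cnorm (Phi W u) @[u --> within [set` I] (nbhs r)] --> cnorm (Phi W r).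
    have /subspace_continuousP/(_ r rI)/cvg_cnormP h := @Phi_cont W.
    apply/cvgrPdist_lt => d d0; have := h d d0; apply: filterS => u.
    by apply: le_lt_trans; rewrite distrC cnorm_dist.
  have Tc : T x y u @[u --> within [set` I] (nbhs r)] --> T x y r.
    apply: (@cvg_big _ _ +%R 0 _ add_continuous _ _ (fpowerset L)
      (fun W u => cnorm (Phi W u))) => W _; exact: Nc.
  have eG : 0 < e * G x y by rewrite mulr_gt0.
  move/cvgrPdist_lt: Tc => /(_ _ eG); rewrite !near_withinE.
  apply: filterS => u hu _ uI; have := hu uI; rewrite ltr_norml => /andP[_ hT].
  rewrite lerBlDr ler_pdivrMr // mulrDl.
  rewrite (le_trans _ (lerD (PhiG x y uI) (lexx _))) // -lerBlDl ltW //.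
- move=> kr [kr0 hk hT]; exists kr; split=> // x y xL yL.
  rewrite -ler_pdivrMr //.
  have xy : (x, y) \in [seq (x, y) | x <- L, y <- L] by apply/allpairsP; exists (x, y).
  exact: (hT _ xy).
Unshelve. all: by end_near. Qed.


Lemma boundary_nonneg Z : 0 <= S Z.
Proof. by apply: sumr_ge0 => x _; apply: sumr_ge0 => y _; rewrite ltW. Qed.

Lemma Phi_boundary_sub Z : (Phi_boundary I Phi Z `<=` Z)%fset.
Proof. by apply/fsubsetP => x; rewrite !inE => /andP[]. Qed.

Lemma boundary_le W : (W `<=` L)%fset -> S W <= \sum_(v <- L | v \in W) w v.
Proof.
move=> WL; rewrite big_fset_condE /=; apply: ler_sum_fsubset.
  apply/fsubsetP => x xW; rewrite !inE /=.
  have xW' := fsubsetP (Phi_boundary_sub W) x xW.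
  by rewrite xW' (fsubsetP WL).
by move=> x _; apply: sumr_ge0 => y _; rewrite ltW.
Qed.

Let surface Z W := ((W `&` Z)%fset != fset0) && ~~ (W `<=` Z)%fset.

Lemma surface_boundary Z W r : r \in I -> surface Z W -> cnorm (Phi W r) != 0 ->
  exists2 x, x \in Phi_boundary I Phi Z & x \in W.
Proof.
move=> rI /andP[/fset0Pn[x]]; rewrite in_fsetI => /andP[xW xZ].
move=> /fsubsetPn[y yW yZ] PW; exists x => //.
rewrite !inE /= xZ /=; apply/asboolP; exists W, r; split=> //.
  split=> //; first by exists x; split.
  by exists y; split=> //; split=> //=; exact/negP.
by move=> P0; move: PW; rewrite P0 cnorm0 eqxx.
Qed.

Lemma P_mono r u : s <= r -> r <= u -> u \in I -> P r <= P u.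
Proof.
move=> sr ru uI; rewrite -subr_ge0.
have := integral_increment phiG_int sI sr ru uI (k := 0); rewrite mulr0; apply.
move=> v /andP[rv vu]; apply: phiG0; apply: (interval_sub sI uI).
by rewrite /= in_itv /= vu (le_trans sr (ltW rv)).
Qed.

Lemma P_ge0 r : s <= r -> r \in I -> 0 <= P r.
Proof.
move=> sr rI; apply: Rintegral_ge0 => v vsr; apply: phiG0.
exact: (interval_sub sI rI).
Qed.

Lemma g_ge0 : 0 <= g.
Proof. by apply: sumr_ge0 => x _; rewrite ltW. Qed.

Lemma majorant_mono eps Z r u : 0 < eps -> s <= r -> r <= u -> u \in I ->
  majorant eps Z r <= majorant eps Z u.
Proof.
move=> e0 sr ru uI; have Pru := P_mono sr ru uI; rewrite /majorant; apply: lerD.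
  apply: ler_wpM2r (boundary_nonneg Z) _ _ _; apply: ler_wpM2l.
    by apply: mulr_ge0 => //; exact: cnorm_ge0.
  by rewrite lerD2r ler_expR; apply: ler_wpM2l.
rewrite /slack ler_pM2l // ler_expR; apply: lerD; last by rewrite lerD2r.
by apply: ler_wpM2l => //; apply: mulr_ge0 => //; exact: g_ge0.
Qed.

Lemma majorant_ge0 eps Z r : 0 < eps -> s <= r -> r \in I -> 0 <= majorant eps Z r.
Proof.
move=> e0 sr rI; rewrite /majorant addr_ge0 //; last by rewrite mulr_ge0 ?expR_ge0 // ltW.
rewrite mulr_ge0 ?boundary_nonneg // mulr_ge0 ?mulr_ge0 ?cnorm_ge0 // subr_ge0.
by rewrite -expR0 ler_expR mulr_ge0 // P_ge0.
Qed.

Lemma commutator_sum_le V0 (F : {fset Gamma} -> A) (p : pred {fset Gamma}) :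
  cnorm (commutator (star V0 * (\sum_(W <- fpowerset L | p W) F W) * V0) c) <=
  \sum_(W <- fpowerset L | p W) cnorm (commutator (star V0 * F W * V0) c).
Proof.
have -> : commutator (star V0 * (\sum_(W <- fpowerset L | p W) F W) * V0) c =
    \sum_(W <- fpowerset L | p W) commutator (star V0 * F W * V0) c.
  apply: (big_morph (fun x => commutator (star V0 * x * V0) c)).
    by move=> x y; rewrite mulrDr mulrDl -!gcomm1 gcommDl.
  by rewrite mulr0 mul0r /commutator mul0r mulr0 subrr.
exact: cnorm_sum.
Qed.

Lemma interaction_observable W r : r \in I -> (W `&` Y = fset0)%fset ->
  observable_in 1 W (Phi W r).
Proof.
move=> rI WY; split.
- by rewrite -[1]/(1%:C%C) normc_real normr1.
- by move=> W' t tI W'W; rewrite PhiC // fsetIC.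
- by rewrite gcomm1 /commutator Phi_c // subrr.
Qed.

(** A surface set disjoint from [Y] carries an observable to which the bound at time [r] applies;
    one meeting [Y] gets the trivial bound, recorded by the indicator in [boundary_sum]. *)
Lemma surface_commutator eps Z r kr : 0 < eps -> s <= r -> r \in I ->
  bounded_at eps r -> (Z `<=` L)%fset -> 0 <= kr ->
  (forall x y, x \in L -> y \in L ->
    \sum_(W <- fpowerset L | (x \in W) && (y \in W)) cnorm (Phi W r) <= kr * G x y) ->
  cnorm (commutator
    (star (V r) * (\sum_(W <- fpowerset L | surface Z W) Phi W r) * V r) c) <=
  kr * (2 * cnorm c * expR (2 * P r) * S Z + slack eps r * g).
Proof.
move=> e0 sr rI Dr ZL kr0 krT.
have q0 : 0 <= slack eps r by rewrite mulr_ge0 ?expR_ge0 // ltW.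
have c0 : 0 <= 2 * cnorm c by rewrite mulr_ge0 // cnorm_ge0.
have E1 : 1 <= expR (2 * P r) by rewrite -expR0 ler_expR mulr_ge0 // P_ge0.
apply: le_trans (commutator_sum_le _ _ _) _.
have ZbL := fsubset_trans (Phi_boundary_sub Z) ZL.
apply: le_trans (boundary_sum (fun W => cnorm_ge0 (Phi W r)) (fun x y => ltW (G0 x y))
  krT GG kr0 ZbL YL c0 E1 q0 boundary_nonneg boundary_le
  (fun W _ => @surface_boundary Z W r rI)).
rewrite big_seq_cond [leRHS]big_seq_cond; apply: ler_sum => W /andP[WL _].
have [WY|WY] := eqVneq (W `&` Y)%fset fset0.
  rewrite -gcomm1 mulr0 add0r mulrC; apply: Dr => //; first by rewrite -fpowersetE.
  exact: interaction_observable.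
rewrite -gcomm1 (le_trans (cnorm_gcomm _ _ _)) //.
  by rewrite -[1]/(1%:C%C) normc_real normr1.
have nV : cnorm (V r) = 1 := cnorm_unitary (uV rI).
apply: (le_trans (_ : _ <= cnorm (Phi W r) * (2 * cnorm c * 1))).
  rewrite mulr1 mulrC ler_wpM2r // -[leRHS]mul1r -[leRHS]mulr1.
  by rewrite !cnormM_le ?cnorm_star ?nV.
rewrite ler_wpM2l ?cnorm_ge0 // -addrA lerDl addr_ge0 //.
by rewrite !mulr_ge0 ?boundary_nonneg ?cnorm_ge0 // subr_ge0.
Qed.

Lemma hamiltonian_split Z r : hamiltonian Phi L r =
  \sum_(W <- fpowerset L | ((W `&` Z)%fset != fset0) && (W `<=` Z)%fset) Phi W r
  + \sum_(W <- fpowerset L | surface Z W) Phi W r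
  + \sum_(W <- fpowerset L | (W `&` Z)%fset == fset0) Phi W r.
Proof.
rewrite /hamiltonian (bigID (fun W => (W `&` Z)%fset == fset0)) /= addrC.
by congr (_ + _); rewrite (bigID (fun W => W `<=` Z)%fset).
Qed.

(** Terms inside [Z] commute with every term away from [Z], and with [c] since [Z] misses [Y];
    conjugation by them therefore preserves all the defining relations. *)
Lemma observable_conj k Z b r h : r \in I -> (Z `&` Y = fset0)%fset ->
  observable_in k Z b ->
  observable_in k Z (star (euler h
    (\sum_(W <- fpowerset L | ((W `&` Z)%fset != fset0) && (W `<=` Z)%fset) Phi W r))
    * b * euler h
    (\sum_(W <- fpowerset L | ((W `&` Z)%fset != fset0) && (W `<=` Z)%fset) Phi W r)).
Proof.
move=> rI ZY [k1 bC bc]; set H := \sum_(W <- _ | _) _.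
have sH : star H = H by rewrite star_sum; apply: eq_bigr => W _; rewrite starPhi.
have HC x : (forall W, (W `<=` Z)%fset -> Phi W r * x = x * Phi W r) -> H * x = x * H.
  move=> hx; rewrite /H mulr_suml mulr_sumr; apply: eq_bigr => W /andP[_ WZ].
  exact: hx.
have sub W X : (W `<=` Z)%fset -> (Z `&` X = fset0)%fset -> (W `&` X = fset0)%fset.
  by move=> WZ ZX; apply/eqP; rewrite -fsubset0 -ZX fsetSI.
have eC x : H * x = x * H -> euler h H * x = x * euler h H /\
    star (euler h H) * x = x * star (euler h H).
  move=> Hx; rewrite star_euler // /euler !mulrDl !mulrDr mulNr mulrN.
  by rewrite !mul1r !mulr1 -!scalerAl -!scalerAr Hx.
split=> //.
- move=> W t tI WZ.
  have /eC[e1 e2] : H * Phi W t = Phi W t * H.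
    by apply: HC => W' W'Z; rewrite PhiC // (sub _ _ W'Z) // fsetIC.
  by rewrite -!mulrA e1 !mulrA -(mulrA _ b) bC // !mulrA e2.
- have /eC[e1 e2] : H * c = c * H.
    by apply: HC => W WZ; rewrite Phi_c // (sub _ _ WZ).
  move/eqP: bc; rewrite subr_eq0 => /eqP bc; apply/eqP; rewrite subr_eq0; apply/eqP.
  rewrite -!mulrA e1 !mulrA -(mulrA _ b) bc -scalerAr -!scalerAl.
  by rewrite !mulrA e2.
Qed.

(** Both exponentials are bounded below by their tangents at [r], and the increment of [P] by
    [(u - r) * (kr - e)]. The summand [t - s] in [slack] provides the strict gain. *)
Lemma majorant_increment eps Z r kr p : 0 < eps -> s <= r -> r \in I ->
  (forall e, 0 < e -> \forall u \near r^'+, u \in I -> kr - e <= phiG u) ->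
  p = kr * (2 * cnorm c * expR (2 * P r) * S Z + slack eps r * g) ->
  \forall u \near r^'+, u \in I ->
    majorant eps Z r + (u - r) * (2 * p + slack eps r / 2) <= majorant eps Z u.
Proof.
move=> e0 sr rI krP ->.
pose B := 2 * cnorm c * expR (2 * P r) * S Z; pose q := slack eps r.
have B0 : 0 <= B.
  by rewrite /B !mulr_ge0 ?boundary_nonneg ?cnorm_ge0 ?expR_ge0.
have q0 : 0 < q by rewrite /q /slack mulr_gt0 ?expR_gt0.
have qg0 : 0 <= q * g by rewrite mulr_ge0 ?g_ge0 // ltW.
have D0 : 0 < 1 + 2 * (B + q * g).
  by apply: ltr_pwDl => //; apply: mulr_ge0 => //; apply: addr_ge0.
(* Replacing [kr] by [kr - e] then costs at most half of the gain [q]; the other half remains in the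
   conclusion. *)
pose e := q / 2 / (1 + 2 * (B + q * g)).
have ep : 0 < e by rewrite /e divr_gt0 // divr_gt0.
have eB : e * (2 * (B + q * g)) <= q / 2.
  have : e * (1 + 2 * (B + q * g)) = q / 2 by rewrite /e divfK // gt_eqF.
  rewrite mulrDr mulr1; lra.
have [d d0 hd] := near_rightP (krP e ep).
near=> u => uI.
have ru : r < u by near: u; exact: nbhs_right_gt.
have ud : u < r + d by near: u; apply: nbhs_right_lt; rewrite ltrDl.
have dP : (u - r) * (kr - e) <= P u - P r.
  apply: (integral_increment phiG_int sI sr (ltW ru) uI) => v /andP[rv vu].
  apply: hd; first by rewrite rv (le_lt_trans vu).
  by apply: (interval_sub rI uI); rewrite /= in_itv /= vu ltW.
rewrite -/B -/q.
have mE : majorant eps Z u = 2 * cnorm c * (expR (2 * P r) * expR (2 * (P u - P r)) - 1) * S Z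
    + q * expR (2 * g * (P u - P r) + (u - r)).
  rewrite /majorant /q /slack -[_ * expR (2 * g * _ + _) in RHS]mulrA -!expRD.
  congr (_ * (expR _ - 1) * _ + _ * expR _); ring.
have h1 : 1 + 2 * (P u - P r) <= expR (2 * (P u - P r)) := expR_ge1Dx _.
have h2 : 1 + (2 * g * (P u - P r) + (u - r)) <= expR (2 * g * (P u - P r) + (u - r)) :=
  expR_ge1Dx _.
have g0 := g_ge0.
rewrite mE.
apply: (le_trans (_ : _ <= majorant eps Z r + B * (2 * (P u - P r))
   + q * (2 * g * (P u - P r) + (u - r)))); last first.
  have -> : 2 * cnorm c * (expR (2 * P r) * expR (2 * (P u - P r)) - 1) * S Z =
     2 * cnorm c * (expR (2 * P r) - 1) * S Z + B * (expR (2 * (P u - P r)) - 1).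
    by rewrite /B; ring.
  rewrite /majorant -/q -!addrA lerD2l [q + _]addrCA; apply: lerD.
    by apply: ler_wpM2l => //; rewrite lerBrDl.
  by rewrite -[X in X + _]mulr1 -mulrDr; apply: ler_wpM2l => //; exact: ltW.
rewrite -[leRHS]addrA lerD2l.
apply: (le_trans (_ : _ <= (u - r) * (kr - e) * (2 * (B + q * g)) + q * (u - r))).
  have h0 : 0 <= u - r by rewrite subr_ge0 ltW.
  have -> : (u - r) * (kr - e) * (2 * (B + q * g)) + q * (u - r) =
    (u - r) * (2 * (kr * (B + q * g)) + (q - e * (2 * (B + q * g)))) by ring.
  apply: ler_wpM2l => //; rewrite lerD2l; lra.
have -> : B * (2 * (P u - P r)) + q * (2 * g * (P u - P r) + (u - r)) =
  (P u - P r) * (2 * (B + q * g)) + q * (u - r) by ring.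
rewrite lerD2r; apply: ler_wpM2r => //.
by apply: mulr_ge0 => //; apply: addr_ge0.
Unshelve. all: by end_near. Qed.

Lemma bounded_at_right eps r : 0 < eps -> s <= r -> r \in I -> bounded_at eps r ->
  \forall u \near r^'+, u \in I -> bounded_at eps u.
Proof.
move=> e0 sr rI Dr; have [kr [kr0 krT krP]] := PhiG_right rI.
have star_sumPhi (Q : pred {fset Gamma}) :
    star (\sum_(W <- fpowerset L | Q W) Phi W r) = \sum_(W <- fpowerset L | Q W) Phi W r.
  by rewrite star_sum; apply: eq_bigr => W _; rewrite starPhi.
have step Z : Z \in fpowerset L -> \forall u \near r^'+, u \in I ->
    (Z `&` Y = fset0)%fset -> forall k b, observable_in k Z b ->
    cnorm (gcomm k (star (V u) * b * V u) c) <= majorant eps Z u * cnorm b.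
  move=> ZL; rewrite fpowersetE in ZL.
  have [ZY|ZY] := eqVneq (Z `&` Y)%fset fset0; last first.
    by near=> u => _ h; move: ZY; rewrite h eqxx.
  have pP := surface_commutator e0 sr rI Dr ZL kr0 krT.
  have e10 : 0 < slack eps r / 2 by rewrite divr_gt0 // mulr_gt0 // expR_gt0.
  have inc := majorant_increment (Z := Z) e0 sr rI krP erefl.
  have dVr := dV rI; rewrite (hamiltonian_split Z) in dVr.
  have near1 := gcomm_near uV (K := fun k b => observable_in k Z b) rI dVr
    (star_sumPhi _) (star_sumPhi _) (star_sumPhi _) _ pP
    (majorant_ge0 Z e0 sr rI) e10.
  near=> u => uI _ k b kb.
  apply: (le_trans (_ : _ <= (majorant eps Z r + (u - r) *
     (2 * (kr * (2 * cnorm c * expR (2 * P r) * S Z + slack eps r * g)) + slack eps r / 2))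
     * cnorm b)).
    move: uI k b kb; near: u; apply: near1.
    move=> k b kb; have [k1 bC bc] := kb; split=> //.
    - rewrite mulr_sumr mulr_suml; apply: eq_bigr => W /eqP WZ; exact: bC.
    - exact: Dr.
    - by move=> h; apply: observable_conj.
  apply: ler_wpM2r; first exact: cnorm_ge0.
  by move: uI; near: u; exact: inc.
(* Only finitely many regions lie in [L], so their neighbourhoods can be intersected. *)
apply: filterS (@filter_bigI _ _ (fpowerset L) _ r^'+ _ step).
move=> u hu uI k Z b ZL ZY kb; apply: (hu Z) => //=.
by rewrite fpowersetE.
Unshelve. all: by end_near. Qed.

(** The commutator is continuous from the left and the majorant is nondecreasing, so the bound
    passes to the limit. *)
Lemma bounded_at_left eps r : 0 < eps -> s < r -> r \in I ->
  (forall u, s <= u < r -> bounded_at eps u) -> bounded_at eps r.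
Proof.
move=> e0 sr rI Du k Z b ZL ZY kb; apply/ler_addgt0Pr => d d0.
have d1 : 0 < d / (cnorm b + 1) by rewrite divr_gt0 // ltr_wpDl ?cnorm_ge0.
have [u /andP[su ur] hu] :=
  near_left_exists (gcomm_left uV c rI (dV rI) d1) sr.
have uI : u \in I by apply: (interval_sub sI rI); rewrite /= in_itv /= !ltW.
have [k1 _ _] := kb.
apply: le_trans (hu uI k b k1) _; apply: lerD.
  apply: (le_trans (Du u _ k Z b ZL ZY kb)); first by rewrite ltW.
  by apply: ler_wpM2r; [exact: cnorm_ge0|apply: majorant_mono => //; exact: ltW].
rewrite mulrAC ler_pdivrMr ?ltr_wpDl ?cnorm_ge0 //.
by rewrite ler_pM2l // lerDl.
Qed.

Lemma graded_lieb_robinson k Z b t : (Z `<=` L)%fset -> (Z `&` Y = fset0)%fset ->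
  observable_in k Z b -> s <= t -> t \in I ->
  cnorm (gcomm k (star (V t) * b * V t) c) <=
  2 * cnorm b * cnorm c * (expR (2 * P t) - 1) * S Z.
Proof.
move=> ZL ZY kb st tI.
have tr r : s <= r <= t -> r \in I.
  by move=> srt; apply: (interval_sub sI tI); rewrite /= in_itv.
have Dt eps : 0 < eps -> bounded_at eps t.
  move=> e0; apply: (@real_induction _ (bounded_at eps) s t st).
  - move=> k' Z' b' Z'L Z'Y [k1 _ bc].
    rewrite V1 star1 mul1r mulr1 bc cnorm0.
    by apply: mulr_ge0; [exact: majorant_ge0|exact: cnorm_ge0].
  - move=> r /andP[sr rt] Dr.
    have rI : r \in I by apply: tr; rewrite sr ltW.
    near=> u => ut.
    have ru : r < u by near: u; exact: nbhs_right_gt.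
    have uI : u \in I by apply: tr; rewrite ut (le_trans sr (ltW ru)).
    by move: uI; near: u; exact: bounded_at_right.
  - move=> r /andP[sr rt] Du; apply: bounded_at_left => //.
    by apply: tr; rewrite rt ltW.
apply/ler_addgt0Pr => d d0.
(* With [eps = d / x] the slack contributes at most [d]; the added 1 keeps [x] positive when [b] is
   zero. *)
pose x := expR (2 * g * P t + (t - s)) * (cnorm b + 1).
have x0 : 0 < x by rewrite mulr_gt0 ?expR_gt0 // ltr_wpDl ?cnorm_ge0.
apply: le_trans (Dt (d / x) _ k Z b ZL ZY kb) _; first exact: divr_gt0.
rewrite /majorant mulrDl; apply: lerD.
  by rewrite le_eqVlt; apply/orP; left; apply/eqP; ring.
rewrite /slack -mulrA mulrAC ler_pdivrMr // ler_pM2l // /x.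
by apply: ler_wpM2l; [exact: expR_ge0|rewrite lerDl].
Unshelve. all: by end_near. Qed.

End LiebRobinson.

Theorem theorem3p1 (R : realType) (Gamma : countType) (d : Gamma -> Gamma -> R)
    (G : Gamma -> Gamma -> R) (A : cstarAlgType R) (a : Gamma -> A)
    (I : interval R) (Phi : {fset Gamma} -> R -> A) (phiG : R -> R)
    (L X Y : {fset Gamma}) (U : R -> R -> A)
    (hd : is_metric d) (hG : is_decay_kernel G) (ha : is_CAR_algebra a)
    (hPhi : in_BG a I G Phi phiG) (hU : is_propagator a I Phi L U)
    (hX : (X `<=` L)%fset) (hY : (Y `<=` L)%fset)
    (hXY : (X `&` Y = fset0)%fset) :
  (forall (b c : A), local_alg a [set` X] b -> local_alg a [set` Y] c ->
     commutator b c = 0 ->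
     forall s t : R, s \in I -> t \in I -> s <= t ->
       cnorm (commutator (dynamics U t s b) c) <=
       2 * cnorm b * cnorm c *
       (expR (2 * \int[@lebesgue_measure R]_(r in `[s, t]) phiG r) - 1) *
       \sum_(x <- Phi_boundary I Phi X) \sum_(y <- Y) G x y)
  /\
  (forall (b c : A), local_alg a [set` X] b -> local_alg a [set` Y] c ->
     anticommutator b c = 0 ->
     forall s t : R, s \in I -> t \in I -> s <= t ->
       cnorm (anticommutator (dynamics U t s b) c) <=
       2 * cnorm b * cnorm c *
       (expR (2 * \int[@lebesgue_measure R]_(r in `[s, t]) phiG r) - 1) *
       \sum_(x <- Phi_boundary I Phi X) \sum_(y <- Y) G x y).
Proof.
have [[Phis Phieven Phic] phiI phi0 PhiG] := hPhi.
have [G0 _ GG _] := hG.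
have comm W Z t x : t \in I -> local_alg a [set` Z] x -> (W `&` Z = fset0)%fset ->
    Phi W t * x = x * Phi W t.
  move=> tI xZ; apply: (even_commute ha) => //; first exact: Phieven.
  exact: Phis.
have bound (k : R[i]) b c s t : ComplexField.Normc.normc k = 1 ->
    local_alg a [set` X] b -> local_alg a [set` Y] c -> gcomm k b c = 0 ->
    s \in I -> t \in I -> s <= t ->
    cnorm (gcomm k (dynamics U t s b) c) <=
    2 * cnorm b * cnorm c *
    (expR (2 * \int[@lebesgue_measure R]_(r in `[s, t]) phiG r) - 1) *
    \sum_(x <- Phi_boundary I Phi X) \sum_(y <- Y) G x y.
  move=> k1 bX cY bc sI tI st; have [Uss hUs] := hU _ sI.
  apply: (@graded_lieb_robinson R A Gamma G I Phi phiG L Y (U ^~ s) c s) => //.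
  - by move=> x y; apply: sum_le_esum (GG x y).
  - move=> W W' u v uI vI WW'; apply: (comm _ W') => //.
    by have [] := Phieven W' v vI.
  - by move=> W u uI; apply: comm.
  - move=> x y u uI.
    by apply: sum_le_esum (PhiG x y u uI) => W _ /andP[].
  - by move=> u uI; have [] := hUs _ uI.
  - by move=> u uI; have [] := hUs _ uI.
  (* Even interaction terms commute with everything on a disjoint set, so an arbitrary [b], odd or
     even, is an observable in [X]. *)
  - by split=> // W u uI WX; rewrite (comm W X).
have n1 : ComplexField.Normc.normc (1 : R[i]) = 1.
  by rewrite -[1]/(1%:C%C) normc_real normr1.
have nN1 : ComplexField.Normc.normc (-1 : R[i]) = 1.
  by rewrite /= oppr0 expr0n addr0 sqrrN expr1n sqrtr1.
split=> b c bX cY bc s t sI tI st.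
  by rewrite -gcomm1; apply: bound => //; rewrite gcomm1.
by rewrite -gcommN1; apply: bound => //; rewrite gcommN1.
Qed.
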